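(* The spectral measures $\nu_{\rho_1}$, $\nu_{\rho_2}$ (over $\chi_{\rho_1}(\mathbb{T}^2)=[-4,4]$, $\chi_{\rho_2}(\mathbb{T}^2)=[-1,3]$ respectively) for the graphs $\mathcal{H}^{D_4^{(2)}}_{\rho_1}$, $\mathcal{H}^{D_4^{(2)}}_{\rho_2}$ respectively, for $SO(4)$, are given by $$\mathrm{d}\nu_{\rho_1}(x)=\frac{1}{8\pi^2}\,K\!\left(\frac{16-x^2}{16}\right)\mathrm{d}x,\qquad \mathrm{d}\nu_{\rho_2}(y)=\frac{1}{\pi\sqrt{(y+1)(3-y)}}\,\mathrm{d}y.$$
   Context: $K(m)=\int_0^{\pi/2}(1-m\sin^2\theta)^{-1/2}\,\mathrm{d}\theta$ is the complete elliptic integral of the first kind, as a function of the parameter $m$. Here $\rho_1=(1,0)$, $\rho_2=(1,1)$, with characters on $\mathbb{T}^2$ $$\chi_{\rho_1}(\omega_1,\omega_2)=\omega_1+\omega_1^{-1}+\omega_2+\omega_2^{-1},\qquad \chi_{\rho_2}(\omega_1,\omega_2)=1+\omega_1\omega_2+\omega_1^{-1}\omega_2^{-1}$$ (restrictions of irreducible characters of $SO(4)$ to its maximal torus; its Weyl group is $D_4^{(2)}=\langle -I,\begin{pmatrix}0&1\\1&0\end{pmatrix}\rangle$). With $\sigma_\mu(\omega_1,\omega_2)=\omega_1^{\mu_1}\omega_2^{\mu_2}$, the graph $\mathcal{H}^{D_4^{(2)}}_{\rho}$ has vertex set $\mathbb{Z}^2$ and $n^\rho_{\mu\nu}$ edges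 from $\mu$ to $\nu$, where $\chi_\rho\sigma_\mu=\sum_\nu n^\rho_{\mu\nu}\sigma_\nu$. Its adjacency operator $A_\rho$ on $\ell^2(\mathbb{Z}^2)$ is bounded and self-adjoint. The spectral measure $\nu_\rho$ of the graph is the compactly supported probability measure determined by $\langle A_\rho^m\delta_{(0,0)},\delta_{(0,0)}\rangle=\int t^m\,\mathrm{d}\nu_\rho(t)$ for all integers $m\ge0$.
   Formalization: The constant in dν_{ρ_1} is 1/(2π²) instead of the printed 1/(8π²): since ∫_{-4}^{4} K((16−x²)/16)dx = 2π², the printed density has total mass 1/4, while ν_{ρ_1} is a probability measure. *)

(* Defs.v *)
From HB Require Import structures.
From mathcomp Require Import all_boot all_order all_algebra.
From mathcomp Require Import complex.
From mathcomp Require Import all_classical all_reals all_analysis.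
From mathcomp Require summability.

Set Implicit Arguments.
Unset Strict Implicit.
Unset Printing Implicit Defensive.

Import Order.TTheory GRing.Theory Num.Theory.
Import numFieldNormedType.Exports.

Local Open Scope classical_set_scope.
Local Open Scope ring_scope.
Local Open Scope complex_scope.

Notation Z2 := (int * int)%type.

Section torus.
Variable R : realType.

Definition torus : set (R[i] * R[i]) :=
  [set w | `|w.1| = 1 /\ `|w.2| = 1].

Definition sigma (mu : Z2) (w : R[i] * R[i]) : R[i] :=
  w.1 ^ mu.1 * w.2 ^ mu.2.

Definition chi_rho1 (w : R[i] * R[i]) : R[i] :=
  w.1 + w.1^-1 + w.2 + w.2^-1.

Definition chi_rho2 (w : R[i] * R[i]) : R[i] :=
  1 + w.1 * w.2 + w.1^-1 * w.2^-1.

(* A graph with vertex set Z^2 is given by n, where n mu nu is the number of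
   edges from mu to nu.  The finiteness clause is needed because \sum_(_ \in _)
   is 0 when the support is infinite. *)
Definition is_edge_multiplicity (chi : R[i] * R[i] -> R[i])
    (n : Z2 -> Z2 -> nat) : Prop :=
  forall mu : Z2,
    finite_set [set nu | n mu nu != 0%N] /\
    forall w, torus w ->
      chi w * sigma mu w = \sum_(nu \in [set: Z2]) (n mu nu)%:R * sigma nu w.

(* The characters sigma nu are linearly independent on the torus, so at most
   one n qualifies; the default value is not reached for chi_rho1 and
   chi_rho2. *)
Definition edge_multiplicity (chi : R[i] * R[i] -> R[i]) : Z2 -> Z2 -> nat :=
  xget (fun _ _ => 0%N) [set n | is_edge_multiplicity chi n].

End torus.

Section ell2.
Variable R : realType.

Definition square_summable (f : Z2 -> R[i]) : Prop :=
  (\esum_(mu in [set: Z2]) (ComplexField.Normc.normc (f mu) ^+ 2)%:E < +oo)%E.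

Definition ell2 : Type := {f : Z2 -> R[i] | square_summable f}.

(* Unconditional sum over the net of finite subsets of Z^2; linear in the
   first argument. *)
Definition inner (f g : ell2) : R[i] :=
  @summability.sum Z2 R[i] R[i]^o (fun mu => sval f mu * (sval g mu)^*).

Definition dirac_fun (x mu : Z2) : R[i] := (mu == x)%:R.

Lemma dirac_fun_square_summable (x : Z2) : square_summable (dirac_fun x).
Proof.
rewrite /square_summable.
have -> : (fun mu => (ComplexField.Normc.normc (dirac_fun x mu) ^+ 2)%:E) =
    (fun mu => if mu \in [set x] then 1%E else 0%E :> \bar R).
  apply/funext => mu; rewrite /dirac_fun.
  case: eqVneq => [->|mux].
    by rewrite mem_set// ComplexField.Normc.normc1 expr1n.
  rewrite memNset; last by move=> /= /eqP; rewrite (negbTE mux).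
  by rewrite ComplexField.Normc.normc0 expr0n.
rewrite -esum_mkcond esum_set1//.
exact: ltry.
Qed.

Definition delta (x : Z2) : ell2 := exist _ _ (dirac_fun_square_summable x).

Definition is_adjacency_operator (n : Z2 -> Z2 -> nat) (A : ell2 -> ell2) :=
  forall (f : ell2) (mu : Z2),
    sval (A f) mu = \sum_(nu \in [set: Z2]) (n mu nu)%:R * sval f nu.

Definition is_spectral_measure (n : Z2 -> Z2 -> nat)
    (P : probability (measurableTypeR R) R) : Prop :=
  (exists2 C : set R, compact C & P (~` C) = 0%E) /\
  exists2 A : ell2 -> ell2, is_adjacency_operator n A &
    forall m : nat,
      inner (iter m A (delta (0, 0))) (delta (0, 0)) =
      (\int[P]_t (t ^+ m))%:C.

(* A compactly supported measure is determined by its moments, so at most one P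
   qualifies; the default value is reached only if there is none. *)
Definition spectral_measure (n : Z2 -> Z2 -> nat) :
    probability (measurableTypeR R) R :=
  xget (\d_(0 : measurableTypeR R) : probability (measurableTypeR R) R)
    [set P | is_spectral_measure n P].

(* Extended-real valued: ellipticK 1 = +oo. *)
Definition ellipticK (m : R) : \bar R :=
  (\int[lebesgue_measure]_(theta in `[0%R, (pi / 2)%R])
     ((1 - m * sin theta ^+ 2) `^ (- 2^-1))%:E)%E.

(* The published constant is 1 / (8 pi^2), which gives this density total mass
   1/4, because the integral of K((16 - x^2) / 16) over [-4, 4] is 2 pi^2; the
   spectral measure is a probability measure, which forces 1 / (2 pi^2). *)
Definition density_rho1 (x : R) : \bar R :=
  ((2 * pi ^+ 2)^-1%:E * ellipticK ((16 - x ^+ 2) / 16))%E.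

Definition density_rho2 (y : R) : \bar R :=
  (pi * Num.sqrt ((y + 1) * (3 - y)))^-1%:E.

End ell2.

(* Main.v *)
(* The adjacency operators translate by the exponents of the characters (by
   linear independence of the monomials on the torus), so the moments count
   closed walks on Z^2.  For rho_1 a walk splits, in the coordinates i + j and
   i - j, into two independent simple walks on Z, and the m-th moment is the
   square of (1/pi) int_0^pi (2 cos u)^m du.  For rho_2 the walk stays on the
   diagonal and the moment is (1/pi) int_0^pi (1 + 2 cos u)^m du, which the
   substitution y = 1 + 2 cos u turns into the arcsine density.

   For rho_1, write D = cos^2 t + (x^2/16) sin^2 t, so that
   K((16 - x^2) / 16) = int_0^(pi/2) D^(-1/2) dt.  Integrating the derivatives
   d/dt (sin t cos t D^(-1/2)), d/dx (x^(j+1) D^(-1/2)) and d/dx (x^(j+1) D^(1/2))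
   over the rectangle [-4, 4] x [0, pi/2] gives, for M_j = int x^j K and j even,
   (j+2)^2 M_(j+2) = 16 (j+1)^2 M_j and j M_j <= pi 4^(j+1) <= (j+1) M_j.  The
   Wallis integrals W_j = int_0^pi sin^j satisfy the same relations with
   2 4^j W_j^2 in place of M_j, which forces M_j = 2 4^j W_j^2.

   A compactly supported law is determined by its moments because the polynomials
   (1 - y^n)^(n 2^n) are bounded on [0, 1] and tend pointwise to 1_{y < 1/2}. *)

Require Import Defs.
From HB Require Import structures.
From mathcomp Require Import all_boot all_order all_algebra.
From mathcomp Require Import complex.
From mathcomp Require Import all_classical all_reals all_analysis.
From mathcomp Require Import measurable_realfun.
From mathcomp Require Import ring lra zify.

Set Implicit Arguments.
Unset Strict Implicit.
Unset Printing Implicit Defensive.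

Import Order.TTheory GRing.Theory Num.Theory.
Import numFieldNormedType.Exports.

Local Open Scope classical_set_scope.
Local Open Scope ring_scope.
Local Open Scope complex_scope.

(** * Derivatives, continuity and the fundamental theorem of calculus *)

Section calculus.
Variable R : realType.
Implicit Types (f g : R -> R) (x df dg : R).
Local Notation mu := (@lebesgue_measure R).

Lemma is_derive_mul f g x df dg : is_derive x 1 f df -> is_derive x 1 g dg ->
  is_derive x 1 (fun y => f y * g y) (df * g x + f x * dg).
Proof.
move=> hf hg; apply: (@is_derive_eq _ _ _ _ _ _ _ _ (is_deriveM hf hg)).
by rewrite /GRing.scale/=; ring.
Qed.

Lemma is_derive_add f g x df dg : is_derive x 1 f df -> is_derive x 1 g dg ->
  is_derive x 1 (fun y => f y + g y) (df + dg).
Proof. by move=> hf hg; exact: (is_deriveD hf hg). Qed.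

Lemma is_derive_opp f x df : is_derive x 1 f df ->
  is_derive x 1 (fun y => - f y) (- df).
Proof. by move=> hf; exact: (is_deriveN hf). Qed.

Lemma is_derive_exp f x df n : is_derive x 1 f df ->
  is_derive x 1 (fun y => f y ^+ n) (n%:R * f x ^+ n.-1 * df).
Proof.
move=> hf; have := @is_deriveX _ _ f n x 1 df hf.
rewrite (_ : f ^+ n = (fun y => f y ^+ n)); last first.
  by apply/funext => y; rewrite exprfctE.
by move=> h; apply: (@is_derive_eq _ _ _ _ _ _ _ _ h); rewrite /GRing.scale/=.
Qed.

Lemma is_derive_sqrt f x df : 0 < f x -> is_derive x 1 f df ->
  is_derive x 1 (fun y => Num.sqrt (f y)) (df / (2 * Num.sqrt (f x))).
Proof.
move=> fx0 hf; rewrite mulrC.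
exact: (@is_derive1_comp _ Num.sqrt f _ _ _ (is_derive1_sqrt fx0) hf).
Qed.

Lemma is_derive_inv_sqrt f x df : 0 < f x -> is_derive x 1 f df ->
  is_derive x 1 (fun y => (Num.sqrt (f y))^-1)
    (- (df / 2) * (Num.sqrt (f x))^-1 ^+ 3).
Proof.
move=> fx0 hf.
have q0 : Num.sqrt (f x) != 0 by rewrite gt_eqF// sqrtr_gt0.
have h := @is_deriveV _ (fun y => Num.sqrt (f y)) _ _ _ q0 (is_derive_sqrt fx0 hf).
apply: (@is_derive_eq _ _ _ _ _ _ _ _ h).
by rewrite /GRing.scale/=; field.
Qed.

Lemma integral_FTC f F (a b : R) : a < b ->
  (forall x, is_derive x 1 F (f x)) -> continuous f ->
  (\int[mu]_(x in `[a, b]) (f x)%:E = (F b - F a)%:E)%E.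
Proof.
move=> ab dF cf; rewrite (continuous_FTC2 ab (F := F)) ?EFinB//.
- exact: continuous_subspaceT.
- have cF : continuous F.
    by move=> x; apply/differentiable_continuous/derivable1_diffP; case: (dF x).
  split; first by move=> x _; case: (dF x).
  + exact/cvg_at_right_filter/cF.
  + exact/cvg_at_left_filter/cF.
- by move=> x _; rewrite derive1E; case: (dF x).
Qed.

Lemma Rintegral_FTC f F (a b : R) : a < b ->
  (forall x, is_derive x 1 F (f x)) -> continuous f ->
  \int[mu]_(x in `[a, b]) f x = F b - F a.
Proof. by move=> ab dF cf; rewrite /Rintegral (integral_FTC ab dF cf). Qed.

Lemma integrable_cont f (a b : R) : continuous f ->
  mu.-integrable `[a, b] (EFin \o f).
Proof.
move=> cf; apply: continuous_compact_integrable; first exact: segment_compact.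
exact: continuous_subspaceT.
Qed.

Lemma cont_mul f g : continuous f -> continuous g ->
  continuous (fun x => f x * g x).
Proof. by move=> cf cg x; exact: (continuousM (cf x) (cg x)). Qed.

Lemma cont_add f g : continuous f -> continuous g ->
  continuous (fun x => f x + g x).
Proof. by move=> cf cg x; exact: (continuousD (cf x) (cg x)). Qed.

Lemma cont_sub f g : continuous f -> continuous g ->
  continuous (fun x => f x - g x).
Proof. by move=> cf cg x; exact: (continuousB (cf x) (cg x)). Qed.

Lemma cont_exp f n : continuous f -> continuous (fun x => f x ^+ n).
Proof.
move=> cf; elim: n => [|n IH]; first exact: cst_continuous.
by under eq_fun do rewrite exprS; exact: cont_mul.
Qed.

Lemma cont_cst (c : R) : continuous (fun _ : R => c).
Proof. exact: cst_continuous. Qed.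

(** The derivative is taken as a difference and the conclusion is additive, so that one primitive
    relates two extended-real integrals without subtracting them. *)
Lemma integral_FTC_sub f g F (a b : R) : a < b ->
  (forall x, is_derive x 1 F (f x - g x)) -> continuous f -> continuous g ->
  (\int[mu]_(x in `[a, b]) (f x)%:E =
   \int[mu]_(x in `[a, b]) (g x)%:E + (F b - F a)%:E)%E.
Proof.
move=> ab dF cf cg; rewrite -(integral_FTC ab dF (cont_sub cf cg)).
under [in X in (_ = _ + X)%E]eq_integral do rewrite EFinB.
rewrite integralB_EFin//; [|exact: integrable_cont..].
by rewrite addeC subeK// integrable_fin_num//; exact: integrable_cont.
Qed.

End calculus.

(** * The integrand of the elliptic integral and its derivatives *)

Section elliptic_kernel.
Variable R : realType.
Implicit Types (x t : R).
Local Notation mu := (@lebesgue_measure R).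

(* [ellf x] is the integrand of K((16 - x^2) / 16), with junk value 0 where it
   is singular (x = 0 and cos t = 0). *)
Definition ellD x t : R := 1 - (16 - x ^+ 2) / 16 * sin t ^+ 2.
Definition ellf x t : R := (Num.sqrt (ellD x t))^-1.

Lemma ellDE x t : ellD x t = cos t ^+ 2 + x ^+ 2 / 16 * sin t ^+ 2.
Proof. by rewrite /ellD cos2sin2; field. Qed.

Lemma ellD_ge0 x t : 0 <= ellD x t.
Proof. by rewrite ellDE addr_ge0 ?sqr_ge0// mulr_ge0 ?sqr_ge0// divr_ge0 ?sqr_ge0. Qed.

Lemma ellD_gt0_cos x t : cos t != 0 -> 0 < ellD x t.
Proof.
move=> c0; rewrite ellDE ltr_pwDl ?exprn_even_gt0//.
by rewrite mulr_ge0 ?sqr_ge0// divr_ge0 ?sqr_ge0.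
Qed.

Lemma ellD_gt0_x x t : x != 0 -> 0 < ellD x t.
Proof.
move=> x0; have [c0|] := eqVneq (cos t) 0; last exact: ellD_gt0_cos.
have := cos2Dsin2 t; rewrite ellDE c0 expr0n/= !add0r => ->.
by rewrite mulr1 divr_gt0// exprn_even_gt0.
Qed.

Lemma ellf_ge0 x t : 0 <= ellf x t.
Proof. by rewrite invr_ge0 sqrtr_ge0. Qed.

Lemma sqrt_ellD x t : 0 < ellD x t -> Num.sqrt (ellD x t) = ellD x t * ellf x t.
Proof.
move=> D0; rewrite /ellf -{2}(sqr_sqrtr (ltW D0)) expr2 mulfK//.
by rewrite gt_eqF// sqrtr_gt0.
Qed.

(** Brings terms in D^(-1/2) to the power D^(-3/2), so that a derivative can be compared as a
    polynomial identity in x, sin t and cos t. *)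
Lemma ellf3 x t : 0 < ellD x t -> ellf x t = ellD x t * ellf x t ^+ 3.
Proof.
move=> D0; have q0 : Num.sqrt (ellD x t) != 0 by rewrite gt_eqF// sqrtr_gt0.
by rewrite -{1}(sqr_sqrtr (ltW D0)) /ellf; field.
Qed.

Lemma is_derive_ellD_t x t :
  is_derive t 1 (ellD x) (- ((16 - x ^+ 2) / 8 * sin t * cos t)).
Proof.
pose c : R := (16 - x ^+ 2) / 16.
have h := is_derive_add (is_derive_cst (1 : R) t 1) (is_derive_opp
  (is_derive_mul (is_derive_cst c t 1) (is_derive_exp 2 (is_derive_sin t)))).
apply: (@is_derive_eq _ _ _ _ _ _ _ _ h); rewrite /c /cst/=; by field.
Qed.

Lemma is_derive_ellD_x x t :
  is_derive x 1 (fun y => ellD y t) (x / 8 * sin t ^+ 2).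
Proof.
pose s : R := sin t ^+ 2.
have h := is_derive_add (is_derive_cst (1 : R) x 1) (is_derive_opp
  (is_derive_mul (is_derive_mul (is_derive_add (is_derive_cst (16:R) x 1)
    (is_derive_opp (is_derive_exp 2 (is_derive_id x 1))))
    (is_derive_cst (16^-1:R) x 1)) (is_derive_cst s x 1))).
apply: (@is_derive_eq _ _ _ _ _ _ _ _ h); rewrite /s /cst/=; by field.
Qed.

(** The cubic term simplifies through D - (1 - x^2/16) cos^2 t = x^2/16. *)
Lemma is_derive_ell_t x t : 0 < ellD x t ->
  is_derive t 1 (fun y => sin y * cos y * ellf x y)
   (cos t ^+ 2 * ellf x t - sin t ^+ 2 * (x ^+ 2 / 16) * ellf x t ^+ 3).
Proof.
move=> D0.
have h := is_derive_mul (is_derive_mul (is_derive_sin t) (is_derive_cos t))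
  (is_derive_inv_sqrt D0 (is_derive_ellD_t x t)).
apply: (@is_derive_eq _ _ _ _ _ _ _ _ h); rewrite -!/(ellf _ _).
rewrite [X in _ * X + _ = _](ellf3 D0) [X in _ = _ * X - _](ellf3 D0) !ellDE.
have e := cos2sin2 t.
by field: e.
Qed.

(** Up to the factor x^n, the cubic term is the one in the derivative along t, so it can be
    eliminated between the two. *)
Lemma is_derive_ell_x x t n : 0 < ellD x t ->
  is_derive x 1 (fun y => y ^+ n.+1 * ellf y t)
   (n.+1%:R * x ^+ n * ellf x t
      - sin t ^+ 2 / 16 * x ^+ n.+2 * ellf x t ^+ 3).
Proof.
move=> D0.
have h := is_derive_mul (is_derive_exp n.+1 (is_derive_id x 1))
  (@is_derive_inv_sqrt _ (ellD^~ t) _ _ D0 (is_derive_ellD_x x t)).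
apply: (@is_derive_eq _ _ _ _ _ _ _ _ h); rewrite -!/(ellf _ _) /= !exprS.
by field.
Qed.

(** Starting from D^(1/2) = D D^(-1/2) avoids any cubic term: expanding D separates a sin^2 part
    from a cos^2 part. *)
Lemma is_derive_ell_x_sqrt x t n : 0 < ellD x t ->
  is_derive x 1 (fun y => y ^+ n.+1 * Num.sqrt (ellD y t))
   (n.+2%:R / 16 * (x ^+ n.+2 * sin t ^+ 2 * ellf x t)
      + n.+1%:R * (x ^+ n * cos t ^+ 2 * ellf x t)).
Proof.
move=> D0.
have h := is_derive_mul (is_derive_exp n.+1 (is_derive_id x 1))
  (@is_derive_sqrt _ (ellD^~ t) _ _ D0 (is_derive_ellD_x x t)).
apply: (@is_derive_eq _ _ _ _ _ _ _ _ h) => /=.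
rewrite invfM -/(ellf _ _) sqrt_ellD// ellDE !exprS -(natr1 n.+1).
by field.
Qed.

Lemma continuous_ellf_t x : x != 0 -> continuous (ellf x).
Proof.
move=> x0 t; apply/differentiable_continuous/derivable1_diffP.
by have [] := is_derive_inv_sqrt (ellD_gt0_x t x0) (is_derive_ellD_t x t).
Qed.

Lemma continuous_ellf_x t : cos t != 0 -> continuous (ellf^~ t).
Proof.
move=> t0 x; apply/differentiable_continuous/derivable1_diffP.
by have [] := @is_derive_inv_sqrt _ (ellD^~ t) _ _ (ellD_gt0_cos x t0)
  (is_derive_ellD_x x t).
Qed.

Lemma ellf4 t : ellf 4 t = 1.
Proof.
rewrite /ellf /ellD (_ : 16 - 4 ^+ 2 = 0) ?mul0r ?subr0 ?sqrtr1 ?invr1//.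
by ring.
Qed.

Lemma ellfN x t : ellf (- x) t = ellf x t.
Proof. by rewrite /ellf /ellD sqrrN. Qed.

(** The integrands agree even at the singular point, where both the real power of 0 and the inverse
    of 0 are 0. *)
Lemma ellipticK_ellf x : ellipticK ((16 - x ^+ 2) / 16) =
  (\int[mu]_(t in `[0%R, (pi / 2)%R]) (ellf x t)%:E)%E.
Proof.
apply: eq_integral => t _; congr EFin.
by rewrite powRN -/(ellD x t) powR12_sqrt// ellD_ge0.
Qed.

End elliptic_kernel.

(** * Tonelli's theorem on a product of two measurable sets *)

Section tonelli.
Variable R : realType.
Local Notation mu := (@lebesgue_measure R).
Local Open Scope ereal_scope.

(** Extending g by 0 outside X * Y reduces the claim to the whole plane. Measurability of the inner
    integral comes along because linearity of the iterated integral needs it. *)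
Lemma tonelli_restrict (X Y : set R) (g : R -> R -> \bar R) :
  measurable X -> measurable Y ->
  measurable_fun [set: R * R] (uncurry g) ->
  (forall x y, 0 <= g x y) ->
  measurable_fun X (fun x => \int[mu]_(y in Y) g x y) /\
  \int[mu]_(x in X) \int[mu]_(y in Y) g x y =
  \int[mu]_(y in Y) \int[mu]_(x in X) g x y.
Proof.
move=> mX mY mg g0.
pose h := uncurry g \_ (X `*` Y).
have mh : measurable_fun [set: R * R] h.
  apply: (iffLR (measurable_restrictT (uncurry g) (measurableX mX mY))).
  exact: measurable_funTS.
have h0 z : 0 <= h z by rewrite /h patchE; case: ifP => // _; case: z.
have F x : \int[mu]_y h (x, y) = ((fun x => \int[mu]_(y in Y) g x y) \_ X) x.
  rewrite patchE; case: ifPn => xX.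
    rewrite [RHS]integral_mkcond; apply: eq_integral => y _.
    by rewrite /h !patchE in_setX/= xX.
  by rewrite integral0_eq// => y _; rewrite /h patchE in_setX/= (negbTE xX).
have G y : \int[mu]_x h (x, y) = ((fun y => \int[mu]_(x in X) g x y) \_ Y) y.
  rewrite patchE; case: ifPn => yY.
    rewrite [RHS]integral_mkcond; apply: eq_integral => x _.
    by rewrite /h !patchE in_setX/= yY andbT.
  by rewrite integral0_eq// => x _; rewrite /h patchE in_setX/= (negbTE yY) andbF.
split.
  apply: (iffRL (measurable_restrictT (fun x => \int[mu]_(y in Y) g x y) mX)).
  rewrite [X in measurable_fun _ X](_ : _ = fubini_F mu h); last first.
    by apply/funext => x; rewrite -F.
  exact: measurable_fun_fubini_tonelli_F.
rewrite integral_mkcond [RHS]integral_mkcond.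
under eq_integral do rewrite -F.
under [RHS]eq_integral do rewrite -G.
exact: (@fubini_tonelli _ _ _ _ _ mu mu h).
Qed.

End tonelli.

(** * Iterated integrals over the rectangle [-4, 4] x [0, pi/2] *)

Section elliptic_moments.
Variable R : realType.
Local Notation mu := (@lebesgue_measure R).
Implicit Types (g h : R -> R -> R) (x t k c : R).

Definition nneg_measurable2 g :=
  measurable_fun [set: R * R] (uncurry (fun x t => (g x t)%:E)) /\
  forall x t, 0 <= g x t.

Definition iint g : \bar R := (\int[mu]_(x in `[(-4)%R, 4%R])
  \int[mu]_(t in `[0%R, (pi / 2)%R]) (g x t)%:E)%E.

Lemma nneg_measurable2P g :
  measurable_fun [set: R * R] (fun z => g z.1 z.2) ->
  (forall x t, 0 <= g x t) -> nneg_measurable2 g.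
Proof.
move=> mg g0; split=> //.
rewrite [X in measurable_fun _ X](_ : _ = EFin \o (fun z => g z.1 z.2)).
  exact/measurable_EFinP.
by apply/funext => -[].
Qed.

Lemma nneg_measurable2_x g x : nneg_measurable2 g ->
  measurable_fun [set: R] (fun t => (g x t)%:E).
Proof.
move=> [mg _]; exact: (measurable_fun_pair2 x mg).
Qed.

Lemma nneg_measurable2_iint g : nneg_measurable2 g ->
  measurable_fun `[(-4 : R), 4] (fun x =>
    \int[mu]_(t in `[0%R, (pi / 2)%R]) (g x t)%:E)%E.
Proof.
move=> [mg g0].
apply: (tonelli_restrict (g := fun x t => (g x t)%:E) _ _ mg _).1 => //.
Qed.

Lemma iintD g h : nneg_measurable2 g -> nneg_measurable2 h ->
  (iint (fun x t => g x t + h x t)%R = iint g + iint h)%E.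
Proof.
move=> Mg Mh; rewrite /iint -ge0_integralD//=; last 4 first.
- by move=> x _; apply: integral_ge0 => t _; rewrite lee_fin; apply Mg.
- exact: nneg_measurable2_iint.
- by move=> x _; apply: integral_ge0 => t _; rewrite lee_fin; apply Mh.
- exact: nneg_measurable2_iint.
apply: eq_integral => x _; under eq_integral do rewrite EFinD.
rewrite ge0_integralD//=.
- by move=> t _; rewrite lee_fin; apply Mg.
- by apply: measurable_funTS; exact: nneg_measurable2_x.
- by move=> t _; rewrite lee_fin; apply Mh.
- by apply: measurable_funTS; exact: nneg_measurable2_x.
Qed.

Lemma iintZ g k : 0 <= k -> nneg_measurable2 g ->
  (iint (fun x t => k * g x t)%R = k%:E * iint g)%E.
Proof.
move=> k0 Mg; rewrite /iint -ge0_integralZl//=; last 2 first.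
- exact: nneg_measurable2_iint.
- by move=> x _; apply: integral_ge0 => t _; rewrite lee_fin; apply Mg.
apply: eq_integral => x _; under eq_integral do rewrite EFinM.
rewrite ge0_integralZl//=.
- by apply: measurable_funTS; exact: nneg_measurable2_x.
- by move=> t _; rewrite lee_fin; apply Mg.
Qed.

(** The null line x = 0 is left out because D vanishes there at t = pi/2, which blocks integration
    of a derivative in t. *)
Lemma iint_eq g h : nneg_measurable2 g -> nneg_measurable2 h ->
  (forall x, (x != 0)%R -> \int[mu]_(t in `[0%R, (pi / 2)%R]) (g x t)%:E =
    \int[mu]_(t in `[0%R, (pi / 2)%R]) (h x t)%:E)%E ->
  iint g = iint h.
Proof.
move=> Mg Mh gh.
have m0 : measurable (`[(-4 : R), 4] `\ 0) by exact: measurableD.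
rewrite /iint -(@integral_setD1 _ _ 0)//; last first.
  by apply: measurable_funS (nneg_measurable2_iint Mg) => //; exact: subDsetl.
rewrite -[RHS](@integral_setD1 _ _ 0)//; last first.
  by apply: measurable_funS (nneg_measurable2_iint Mh) => //; exact: subDsetl.
apply: eq_integral => x; rewrite inE => -[_ /eqP x0]; exact: gh.
Qed.

(** The counterpart for derivatives in x: the order of integration is exchanged and the null line t
    = pi/2 is left out. *)
Lemma iint_eq_t g h : nneg_measurable2 g -> nneg_measurable2 h ->
  (forall t, (cos t != 0)%R -> \int[mu]_(x in `[(-4)%R, 4%R]) (g x t)%:E =
    \int[mu]_(x in `[(-4)%R, 4%R]) (h x t)%:E)%E ->
  iint g = iint h.
Proof.
move=> [mg g0] [mh h0] gh.
(* Half-open, so that cos t > 0 on all of T. *)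
pose T := `[0%R, (pi / 2)%R : R[%classic.
have swap f : measurable_fun [set: R * R] (uncurry (fun x t => (f x t)%:E)) ->
    (forall x t, 0 <= f x t) ->
    (iint f = \int[mu]_(t in T) \int[mu]_(x in `[(-4)%R, 4%R]) (f x t)%:E)%E.
  move=> mf f0.
  rewrite /iint (tonelli_restrict (g := fun x t => (f x t)%:E) _ _ mf _).2//.
  have mf' : measurable_fun [set: R * R] (uncurry (fun t x => (f x t)%:E)).
    rewrite [X in measurable_fun _ X](_ : _ =
      uncurry (fun x t => (f x t)%:E) \o unstable.swap); last by apply/funext => -[].
    by apply: measurableT_comp => //; exact: measurable_swap.
  rewrite integral_itv_bndo_bndc//.
  apply: (tonelli_restrict (g := fun t x => (f x t)%:E) _ _ mf' _).1 => // x t.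
  by rewrite lee_fin.
rewrite !swap//; apply: eq_integral => t; rewrite inE /T/= in_itv/= => /andP[t0 tpi].
apply: gh; rewrite gt_eqF// cos_gt0_pihalf// tpi andbT.
by rewrite (lt_le_trans _ t0)// oppr_lt0 divr_gt0// pi_gt0.
Qed.

Lemma iint_cst k : iint (fun _ _ => k) = (8 * k * (pi / 2))%:E.
Proof.
have pi20 : 0 < pi / 2 :> R by rewrite divr_gt0// pi_gt0.
rewrite /iint.
under eq_integral do
  rewrite integral_cst//= lebesgue_measure_itv/= lte_fin pi20 oppr0 adde0 -EFinM.
rewrite integral_cst//= lebesgue_measure_itv/= lte_fin ifT; last by lra.
by rewrite -EFinD -EFinM; congr EFin; lra.
Qed.

End elliptic_moments.

(** * Recursion and bounds for the even moments of K((16 - x^2) / 16) *)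

Section elliptic_recursion.
Variable R : realType.
Local Notation mu := (@lebesgue_measure R).
Implicit Types (x t : R) (j : nat).

Definition momM j x t := x ^+ j * ellf x t.
Definition momC j x t := x ^+ j * cos t ^+ 2 * ellf x t.
Definition momS j x t := x ^+ j * sin t ^+ 2 * ellf x t.
(** The cubic term shared by the derivatives in t and in x of the kernel. *)
Definition momT j x t := sin t ^+ 2 / 16 * x ^+ j.+2 * ellf x t ^+ 3.

Lemma measurable_fstX j : measurable_fun [set: R * R] (fun z => z.1 ^+ j).
Proof. by apply: measurable_funX; exact: measurable_fst. Qed.

Lemma measurable_cosX j : measurable_fun [set: R * R] (fun z => cos z.2 ^+ j).
Proof.
apply: measurable_funX; apply: (@measurableT_comp _ _ _ _ _ _ cos) => //.
by apply: continuous_measurable_fun; exact: continuous_cos.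
Qed.

Lemma measurable_sinX j : measurable_fun [set: R * R] (fun z => sin z.2 ^+ j).
Proof.
apply: measurable_funX; apply: (@measurableT_comp _ _ _ _ _ _ sin) => //.
by apply: continuous_measurable_fun; exact: continuous_sin.
Qed.

Lemma measurable_ellf : measurable_fun [set: R * R] (fun z => ellf z.1 z.2).
Proof.
rewrite (_ : (fun z => _) = (fun z => ellD z.1 z.2 `^ (- 2^-1))); last first.
  by apply/funext => z; rewrite powRN powR12_sqrt// ellD_ge0.
apply: (@measurableT_comp _ _ _ _ _ _ (@powR R ^~ (- 2^-1))) => //.
apply: measurable_funB => //; apply: measurable_funM; last exact: measurable_sinX.
apply: measurable_funM => //; apply: measurable_funB => //.
exact: measurable_fstX.
Qed.

Lemma nneg_momM j : ~~ odd j -> nneg_measurable2 (momM j).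
Proof.
move=> ej; apply: nneg_measurable2P.
  by apply: measurable_funM; [exact: measurable_fstX|exact: measurable_ellf].
by move=> x t; rewrite mulr_ge0 ?exprn_even_ge0 ?ellf_ge0.
Qed.

Lemma nneg_momC j : ~~ odd j -> nneg_measurable2 (momC j).
Proof.
move=> ej; apply: nneg_measurable2P.
  apply: measurable_funM; last exact: measurable_ellf.
  by apply: measurable_funM; [exact: measurable_fstX|exact: measurable_cosX].
by move=> x t; rewrite mulr_ge0 ?ellf_ge0// mulr_ge0 ?exprn_even_ge0 ?sqr_ge0.
Qed.

Lemma nneg_momS j : ~~ odd j -> nneg_measurable2 (momS j).
Proof.
move=> ej; apply: nneg_measurable2P.
  apply: measurable_funM; last exact: measurable_ellf.
  by apply: measurable_funM; [exact: measurable_fstX|exact: measurable_sinX].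
by move=> x t; rewrite mulr_ge0 ?ellf_ge0// mulr_ge0 ?exprn_even_ge0 ?sqr_ge0.
Qed.

Lemma nneg_momT j : ~~ odd j -> nneg_measurable2 (momT j).
Proof.
move=> ej; apply: nneg_measurable2P.
  apply: measurable_funM; last by apply: measurable_funX; exact: measurable_ellf.
  apply: measurable_funM; last exact: measurable_fstX.
  by apply: measurable_funM => //; exact: measurable_sinX.
move=> x t; rewrite mulr_ge0 ?exprn_ge0 ?ellf_ge0// mulr_ge0//.
  by rewrite mulr_ge0 ?sqr_ge0.
by rewrite exprn_even_ge0//= negbK.
Qed.

Lemma nneg_measurable2_cst (k : R) : 0 <= k -> nneg_measurable2 (fun _ _ => k).
Proof. by move=> k0; apply: nneg_measurable2P. Qed.

Lemma nneg_measurable2_scale (g : R -> R -> R) (k : R) : 0 <= k -> nneg_measurable2 g ->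
  nneg_measurable2 (fun x t => k * g x t).
Proof.
move=> k0 [mg g0]; split; last by move=> x t; rewrite mulr_ge0.
rewrite [X in measurable_fun _ X](_ : _ =
    (fun z => k%:E * uncurry (fun x t => (g x t)%:E) z)%E).
  exact: measurable_funeM.
by apply/funext => -[x t] /=; rewrite EFinM.
Qed.

Lemma nneg_measurable2_add (g h : R -> R -> R) :
  nneg_measurable2 g -> nneg_measurable2 h ->
  nneg_measurable2 (fun x t => g x t + h x t).
Proof.
move=> [mg g0] [mh h0]; split; last by move=> x t; rewrite addr_ge0.
rewrite [X in measurable_fun _ X](_ : _ =
    (fun z => uncurry (fun x t => (g x t)%:E) z + uncurry (fun x t => (h x t)%:E) z)%E).
  exact: emeasurable_funD.
by apply/funext => -[x t] /=; rewrite EFinD.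
Qed.

(** For fixed nonzero x the primitive x^j sin t cos t D^(-1/2) vanishes at both t = 0 and t =
    pi/2. *)
Lemma iint_momC_momT j : ~~ odd j -> iint (momC j) = iint (momT j).
Proof.
move=> ej; apply: iint_eq; [exact: nneg_momC|exact: nneg_momT|move=> x x0].
have pi20 : 0 < pi / 2 :> R by rewrite divr_gt0// pi_gt0.
have cf := continuous_ellf_t x0.
have dF t : is_derive t 1 (fun t => x ^+ j * (sin t * cos t * ellf x t))
    (momC j x t - momT j x t).
  have h := is_derive_mul (is_derive_cst (x ^+ j) t 1)
    (is_derive_ell_t (ellD_gt0_x t x0)).
  by apply: (@is_derive_eq _ _ _ _ _ _ _ _ h); rewrite /momC /momT /cst/= !exprS; field.
rewrite (integral_FTC_sub pi20 dF).
- by rewrite sin0 cos_pihalf mulr0 !mul0r mulr0 subrr adde0.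
- exact (cont_mul (cont_mul (@cont_cst R (x ^+ j))
    (@cont_exp R _ 2 (@continuous_cos R))) cf).
- exact (cont_mul (cont_mul (cont_mul (@cont_exp R _ 2 (@continuous_sin R))
    (@cont_cst R 16^-1))
    (@cont_cst R (x ^+ j.+2))) (@cont_exp R _ 3 cf)).
Qed.

(** Since D = 1 at x = 4 and x = -4, and j is even, x^(j+1) D^(-1/2) grows by 2 4^(j+1) over
    [-4, 4]. Subtracting 4^j x from the primitive cancels this growth exactly. *)
Lemma iint_momM_momT j : ~~ odd j ->
  iint (fun x t => j.+1%:R * momM j x t) = iint (fun x t => momT j x t + 4 ^+ j).
Proof.
move=> ej; apply: iint_eq_t => [||t t0].
- by apply: nneg_measurable2_scale => //; exact: nneg_momM.
- apply: nneg_measurable2_add; first exact: nneg_momT.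
  by apply: nneg_measurable2_cst; rewrite exprn_ge0.
have cf := continuous_ellf_x t0.
have ab : -4 < 4 :> R by lra.
have dF x : is_derive x 1 (fun x => x ^+ j.+1 * ellf x t - 4 ^+ j * x)
    (j.+1%:R * momM j x t - (momT j x t + 4 ^+ j)).
  have h := is_derive_add (is_derive_ell_x j (ellD_gt0_cos x t0))
    (is_derive_opp (is_derive_mul (is_derive_cst ((4 : R) ^+ j : R) x 1)
      (is_derive_id x 1))).
  by apply: (@is_derive_eq _ _ _ _ _ _ _ _ h); rewrite /momM /momT /cst/=; ring.
rewrite (integral_FTC_sub ab dF).
- rewrite [X in (_ + X%:E)%E](_ : _ = 0) ?adde0// ellfN ellf4.
  rewrite !exprS exprNn -signr_odd (negbTE ej).
  by rewrite expr0; ring.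
- exact (cont_mul (@cont_cst R j.+1%:R) (cont_mul (@exprn_continuous R j) cf)).
- exact (cont_add (cont_mul (cont_mul (@cont_cst R (sin t ^+ 2 / 16))
    (@exprn_continuous R j.+2))
    (@cont_exp R _ 3 cf)) (@cont_cst R (4 ^+ j))).
Qed.

(** The same cancellation of boundary terms, with the primitive x^(j+1) D^(1/2) - 4^j x. *)
Lemma iint_momS_momC j : ~~ odd j ->
  iint (fun x t => j.+2%:R / 16 * momS j.+2 x t + j.+1%:R * momC j x t) =
  iint (fun _ _ => 4 ^+ j).
Proof.
move=> ej; have ej2 : ~~ odd j.+2 by rewrite /= negbK.
apply: iint_eq_t => [||t t0].
- apply: nneg_measurable2_add; apply: nneg_measurable2_scale => //.
    exact: nneg_momS.
  exact: nneg_momC.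
- by apply: nneg_measurable2_cst; rewrite exprn_ge0.
have cf := continuous_ellf_x t0.
have ab : -4 < 4 :> R by lra.
have dF x : is_derive x 1 (fun x => x ^+ j.+1 * Num.sqrt (ellD x t) - 4 ^+ j * x)
    (j.+2%:R / 16 * momS j.+2 x t + j.+1%:R * momC j x t - 4 ^+ j).
  have h := is_derive_add (is_derive_ell_x_sqrt j (ellD_gt0_cos x t0))
    (is_derive_opp (is_derive_mul (is_derive_cst ((4 : R) ^+ j : R) x 1)
      (is_derive_id x 1))).
  by apply: (@is_derive_eq _ _ _ _ _ _ _ _ h); rewrite /momS /momC /cst/=; ring.
have D4 : ellD 4 t = 1 by rewrite /ellD (_ : 16 - 4 ^+ 2 = 0) ?mul0r ?subr0//; ring.
rewrite (integral_FTC_sub ab dF).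
- rewrite [X in (_ + X%:E)%E](_ : _ = 0) ?adde0//.
  rewrite {2}/ellD sqrrN -/(ellD 4 t) D4 sqrtr1 !exprS exprNn -signr_odd (negbTE ej).
  by rewrite expr0; ring.
- exact (cont_add
    (cont_mul (@cont_cst R (j.+2%:R / 16))
      (cont_mul (cont_mul (@exprn_continuous R j.+2)
      (@cont_cst R (sin t ^+ 2))) cf))
    (cont_mul (@cont_cst R j.+1%:R) (cont_mul (cont_mul (@exprn_continuous R j)
      (@cont_cst R (cos t ^+ 2))) cf))).
- exact: cont_cst.
Qed.

Lemma iint_momM_split j : ~~ odd j ->
  (iint (momM j) = iint (momC j) + iint (momS j))%E.
Proof.
move=> ej; rewrite -iintD; [|exact: nneg_momC|exact: nneg_momS].
congr iint; apply/funext => x; apply/funext => t.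
by rewrite /momM /momC /momS -mulrDl -mulrDr cos2Dsin2 mulr1.
Qed.

Lemma iint_ge0 (g : R -> R -> R) : nneg_measurable2 g -> (0 <= iint g)%E.
Proof.
move=> [_ g0]; apply: integral_ge0 => x _; apply: integral_ge0 => t _.
by rewrite lee_fin.
Qed.

(* The cos^2 and sin^2 moments eliminate between the three integrated
   identities above; the bounds come from 0 <= momC <= momM, and are what later
   identifies the initial value. *)
Lemma elliptic_moment_recursion : exists M : nat -> R,
  [/\ forall j, ~~ odd j -> iint (momM j) = (M j)%:E,
   forall j, ~~ odd j -> j.+2%:R ^+ 2 * M j.+2 = 16 * j.+1%:R ^+ 2 * M j &
   forall j, ~~ odd j -> j%:R * M j <= pi * 4 ^+ j.+1 <= j.+1%:R * M j].
Proof.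
have E1 j : ~~ odd j ->
    (j.+1%:R%:E * iint (momM j) = iint (momC j) + (pi * 4 ^+ j.+1)%:E)%E.
  move=> ej; rewrite -iintZ//; last exact: nneg_momM.
  rewrite iint_momM_momT// iintD; last 2 first.
  - exact: nneg_momT.
  - exact/nneg_measurable2_cst/exprn_ge0.
  rewrite iint_momC_momT// iint_cst; congr (_ + _%:E)%E; rewrite exprS; by field.
have E2 j : ~~ odd j ->
    ((j.+2%:R / 16)%:E * iint (momS j.+2) + j.+1%:R%:E * iint (momC j)
     = (pi * 4 ^+ j.+1)%:E)%E.
  move=> ej; have ej2 : ~~ odd j.+2 by rewrite /= negbK.
  have nS := nneg_momS ej2; have nC := nneg_momC ej.
  rewrite -!iintZ// -iintD; [|exact: nneg_measurable2_scale..].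
  rewrite iint_momS_momC// iint_cst; congr (_%:E); rewrite exprS; by field.
(* Finiteness is derived: in [E2] nonnegative integrals with positive weights add up to a real
   number, so [momC] is finite; then [E1] gives [momM], and the splitting gives [momS]. *)
have finC j : ~~ odd j -> iint (momC j) \is a fin_num.
  move=> ej; have := E2 j ej; have := iint_ge0 (nneg_momC ej).
  have ej2 : ~~ odd j.+2 by rewrite /= negbK.
  have := iint_ge0 (nneg_momS ej2).
  case: (iint (momS _)) => [s||] //; case: (iint (momC _)) => [c||] // _ _;
    by rewrite ?gt0_muley ?lte_fin ?divr_gt0 ?ltr0n.
have finM j : ~~ odd j -> iint (momM j) \is a fin_num.
  move=> ej; have := E1 j ej; have := iint_ge0 (nneg_momM ej).
  rewrite -(fineK (finC j ej)).
  by case: (iint (momM _)) => // _; rewrite gt0_muley ?lte_fin ?ltr0n.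
have finS j : ~~ odd j -> iint (momS j) \is a fin_num.
  move=> ej; have := iint_momM_split ej; have := iint_ge0 (nneg_momS ej).
  rewrite -(fineK (finC j ej)) -(fineK (finM j ej)).
  by case: (iint (momS _)).
pose M j := fine (iint (momM j)).
pose C j := fine (iint (momC j)).
pose S j := fine (iint (momS j)).
have e1 j : ~~ odd j -> j.+1%:R * M j = C j + pi * 4 ^+ j.+1.
  move=> ej; have := E1 j ej; rewrite -(fineK (finC j ej)) -(fineK (finM j ej)).
  by move=> [].
have e2 j : ~~ odd j -> j.+2%:R / 16 * S j.+2 + j.+1%:R * C j = pi * 4 ^+ j.+1.
  move=> ej; have ej2 : ~~ odd j.+2 by rewrite /= negbK.
  by have := E2 j ej; rewrite -(fineK (finC j ej)) -(fineK (finS _ ej2)) => -[].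
have e3 j : ~~ odd j -> M j = C j + S j.
  move=> ej; have := iint_momM_split ej.
  by rewrite -(fineK (finC j ej)) -(fineK (finM j ej)) -(fineK (finS _ ej)) => -[].
exists M; split => [j ej|j ej|j ej].
- by rewrite fineK// finM.
- have ej2 : ~~ odd j.+2 by rewrite /= negbK.
  have := e1 _ ej; have := e1 _ ej2; have := e2 _ ej; have := e3 _ ej2.
  rewrite -(natr1 j.+2) -(natr1 j.+1) -(natr1 j) !exprS.
  move: (M j) (M j.+2) (C j) (C j.+2) (S j.+2) (4 ^+ j) (j%:R) => m m2 c c2 s p n.
  move=> h3 h2 h1 h0.
  have ec : c = (n + 1) * m - pi * (4 * p) by rewrite h0; ring.
  have es : s = m2 - ((n + 1 + 1 + 1) * m2 - pi * (4 * (4 * (4 * p)))).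
    by rewrite h1 h3; ring.
  by move: h2; rewrite ec es ?expr0 => h2; lra.
- have C0 : 0 <= C j by apply: fine_ge0; exact/iint_ge0/nneg_momC.
  have S0 : 0 <= S j by apply: fine_ge0; exact/iint_ge0/nneg_momS.
  have := e1 _ ej; have := e3 _ ej; rewrite -(natr1 j) => h3 h1.
  apply/andP; split; lra.
Qed.

End elliptic_recursion.

(** * Wallis integrals and the solution of the moment recursion *)

Section wallis.
Variable R : realType.
Local Notation mu := (@lebesgue_measure R).
Implicit Types (f g F : R -> R).

Lemma Rintegral_FTC_sub f g F (a b : R) : a < b ->
  (forall x : R, is_derive x 1 F (f x - g x)) -> continuous f -> continuous g ->
  \int[mu]_(x in `[a, b]) f x = \int[mu]_(x in `[a, b]) g x + (F b - F a).
Proof.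
move=> ab dF cf cg; rewrite /Rintegral (integral_FTC_sub ab dF)// fineD//.
by rewrite integrable_fin_num//; exact: integrable_cont.
Qed.

Lemma RintegralZ_cont f (k a b : R) : continuous f ->
  \int[mu]_(x in `[a, b]) (k * f x) = k * \int[mu]_(x in `[a, b]) f x.
Proof. by move=> cf; rewrite RintegralZl//; exact: integrable_cont. Qed.

Lemma RintegralD_cont f g (a b : R) : continuous f -> continuous g ->
  \int[mu]_(x in `[a, b]) (f x + g x) =
  \int[mu]_(x in `[a, b]) f x + \int[mu]_(x in `[a, b]) g x.
Proof. by move=> cf cg; rewrite RintegralD//; exact: integrable_cont. Qed.

Definition wallis n : R := \int[mu]_(u in `[0, pi]) sin u ^+ n.
Definition cosint n : R := \int[mu]_(u in `[0, pi]) cos u ^+ n.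

Lemma wallis_rec n : n.+2%:R * wallis n.+2 = n.+1%:R * wallis n.
Proof.
rewrite /wallis -!RintegralZ_cont; [|exact/cont_exp/continuous_sin..].
have dF (u : R) : is_derive u 1 (fun u : R => - (cos u * sin u ^+ n.+1))
    (n.+2%:R * sin u ^+ n.+2 - n.+1%:R * sin u ^+ n).
  have h := is_derive_opp (is_derive_mul (is_derive_cos u)
    (is_derive_exp n.+1 (is_derive_sin u))).
  apply: (@is_derive_eq _ _ _ _ _ _ _ _ h); rewrite /= !exprS -(natr1 n.+1).
  have e := cos2sin2 u; ring: e.
rewrite (Rintegral_FTC_sub (pi_gt0 R) dF).
- by rewrite sinpi sin0 !expr0n !mulr0 subrr addr0.
- exact (cont_mul (@cont_cst R n.+2%:R) (@cont_exp R _ n.+2 (@continuous_sin R))).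
- exact (cont_mul (@cont_cst R n.+1%:R) (@cont_exp R _ n (@continuous_sin R))).
Qed.

Lemma cosint_rec n : n.+2%:R * cosint n.+2 = n.+1%:R * cosint n.
Proof.
rewrite /cosint -!RintegralZ_cont; [|exact/cont_exp/continuous_cos..].
have dF (u : R) : is_derive u 1 (fun u : R => sin u * cos u ^+ n.+1)
    (n.+2%:R * cos u ^+ n.+2 - n.+1%:R * cos u ^+ n).
  have h := is_derive_mul (is_derive_sin u) (is_derive_exp n.+1 (is_derive_cos u)).
  apply: (@is_derive_eq _ _ _ _ _ _ _ _ h); rewrite /= !exprS -(natr1 n.+1).
  have e := sin2cos2 u; ring: e.
rewrite (Rintegral_FTC_sub (pi_gt0 R) dF).
- by rewrite sinpi sin0 !mul0r subrr addr0.
- exact (cont_mul (@cont_cst R n.+2%:R) (@cont_exp R _ n.+2 (@continuous_cos R))).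
- exact (cont_mul (@cont_cst R n.+1%:R) (@cont_exp R _ n (@continuous_cos R))).
Qed.

Lemma Rintegral_cst_0pi (k : R) : \int[mu]_(u in `[0, pi]) k = k * pi.
Proof.
rewrite Rintegral_cst//= lebesgue_measure_itv/= lte_fin pi_gt0.
by rewrite oppr0 adde0.
Qed.

Lemma wallis0 : wallis 0 = pi.
Proof.
rewrite /wallis; under eq_Rintegral do rewrite expr0.
by rewrite Rintegral_cst_0pi mul1r.
Qed.

Lemma cosint0 : cosint 0 = pi.
Proof.
rewrite /cosint; under eq_Rintegral do rewrite expr0.
by rewrite Rintegral_cst_0pi mul1r.
Qed.

Lemma wallis1 : wallis 1 = 2.
Proof.
rewrite /wallis; under eq_Rintegral do rewrite expr1.
have dF (u : R) : is_derive u 1 (fun u : R => - cos u) (sin u).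
  have h := is_derive_opp (is_derive_cos u).
  by apply: (@is_derive_eq _ _ _ _ _ _ _ _ h); rewrite opprK.
rewrite (Rintegral_FTC (pi_gt0 R) dF); last exact: continuous_sin.
by rewrite cospi cos0; ring.
Qed.

Lemma cosint1 : cosint 1 = 0.
Proof.
rewrite /cosint; under eq_Rintegral do rewrite expr1.
rewrite (Rintegral_FTC (pi_gt0 R) (fun u => is_derive_sin u)).
  by rewrite sinpi sin0 subrr.
exact: continuous_cos.
Qed.

(** Both sequences follow the same two-step recursion from the value pi at 0. *)
Lemma cosint_wallis n : ~~ odd n -> cosint n = wallis n.
Proof.
move=> en; rewrite -(odd_double_half n) (negbTE en) add0n.
elim: n./2 => [|k IH]; first by rewrite cosint0 wallis0.
have := cosint_rec k.*2; rewrite IH -wallis_rec => /mulfI; apply.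
by rewrite pnatr_eq0.
Qed.

Lemma cosint_odd n : odd n -> cosint n = 0.
Proof.
move=> on; rewrite -(odd_double_half n) on add1n.
elim: n./2 => [|k IH]; first exact: cosint1.
have := cosint_rec k.*2.+1; rewrite IH mulr0 => /eqP.
by rewrite mulf_eq0 pnatr_eq0/= => /eqP.
Qed.

Lemma wallis_ge0 n : 0 <= wallis n.
Proof.
apply: Rintegral_ge0 => // u; rewrite /= in_itv/= => /andP[u0 upi].
by rewrite exprn_ge0// sin_ge0_pi// u0.
Qed.

Lemma wallis_leS n : wallis n.+1 <= wallis n.
Proof.
apply: le_Rintegral => //=; [exact/integrable_cont/cont_exp/continuous_sin..|].
move=> u; rewrite /= in_itv/= => /andP[u0 upi].
rewrite exprS ler_piMl ?sin_le1// exprn_ge0// sin_ge0_pi// u0.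
by [].
Qed.

(** The recursion makes this product independent of n. *)
Lemma wallis_mulS n : n.+1%:R * (wallis n * wallis n.+1) = 2 * pi.
Proof.
elim: n => [|n IH]; first by rewrite wallis0 wallis1; ring.
by rewrite mulrCA wallis_rec -IH; ring.
Qed.

(** As the Wallis integrals decrease, W_n^2 lies between the products W_n W_(n+1) and W_(n-1) W_n,
    both known exactly. *)
Lemma wallis_sqr_bounds n : n%:R * wallis n ^+ 2 <= 2 * pi <= n.+1%:R * wallis n ^+ 2.
Proof.
apply/andP; split; last first.
  rewrite -(wallis_mulS n) ler_pM2l ?ltr0n// expr2 ler_wpM2l ?wallis_ge0//.
  exact: wallis_leS.
case: n => [|n]; first by rewrite mul0r mulr_ge0// pi_ge0.
rewrite -(wallis_mulS n) ler_pM2l ?ltr0n// expr2 ler_wpM2r ?wallis_ge0//.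
exact: wallis_leS.
Qed.

Lemma wallis_gt0 n : 0 < wallis n.
Proof.
rewrite lt0r wallis_ge0 andbT; apply/eqP => w0.
have := wallis_mulS n; rewrite w0 mul0r mulr0 => /esym/eqP.
by rewrite mulf_eq0 pnatr_eq0/= gt_eqF// pi_gt0.
Qed.

(* The right-hand side satisfies the same recursion and the same bounds, so the
   ratio is constant, and it is squeezed to 1. *)
Lemma recursion_eq_wallis (M : nat -> R) :
  (forall j, ~~ odd j -> j.+2%:R ^+ 2 * M j.+2 = 16 * j.+1%:R ^+ 2 * M j) ->
  (forall j, ~~ odd j -> j%:R * M j <= pi * 4 ^+ j.+1 <= j.+1%:R * M j) ->
  forall j, ~~ odd j -> M j = 2 * 4 ^+ j * wallis j ^+ 2.
Proof.
move=> Mrec Mbd.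
pose w j : R := 2 * 4 ^+ j * wallis j ^+ 2.
have w_gt0 j : 0 < w j by rewrite /w !mulr_gt0 ?exprn_gt0 ?wallis_gt0.
pose r := M 0%N / w 0%N.
have Mr j : ~~ odd j -> M j = r * w j.
  move=> en; rewrite -(odd_double_half j) (negbTE en) add0n.
  elim: j./2 => [|k IH]; first by rewrite /r divfK// gt_eqF.
  have ek : ~~ odd k.*2 by rewrite odd_double.
  have n0 : k.*2.+2%:R ^+ 2 != 0 :> R by rewrite expf_neq0// pnatr_eq0.
  apply: (mulfI n0); rewrite doubleS Mrec// IH /w.
  have /(congr1 (fun x => x ^+ 2)) := wallis_rec k.*2; rewrite !exprMn => e.
  transitivity
    (r * (2 * 4 ^+ k.*2.+2) * (k.*2.+2%:R ^+ 2 * wallis k.*2.+2 ^+ 2)); last by ring.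
  by rewrite e !exprS; ring.
have wbd j : j%:R * w j <= pi * 4 ^+ j.+1 <= j.+1%:R * w j.
  have /andP[h1 h2] := wallis_sqr_bounds j.
  have p0 : 0 < 2 * 4 ^+ j :> R by rewrite mulr_gt0// exprn_gt0.
  have -> : pi * 4 ^+ j.+1 = (2 * 4 ^+ j) * (2 * pi) :> R by rewrite exprS; ring.
  rewrite /w; apply/andP; split.
    by rewrite mulrCA ler_pM2l.
  by rewrite [leRHS]mulrCA ler_pM2l.
suff r1 : r = 1 by move=> j ej; rewrite Mr// r1 mul1r.
(* Crossing the bounds for M with those for w at the index 2k confines r to an interval shrinking to
   1; a k beyond 1 / |1 - r| then gives a contradiction. *)
have hk k : k.*2%:R * r <= k.*2.+1%:R /\ k.*2%:R <= k.*2.+1%:R * r.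
  have ek : ~~ odd k.*2 by rewrite odd_double.
  have /andP[a1 a2] := Mbd _ ek; have /andP[b1 b2] := wbd k.*2.
  have e := Mr _ ek.
  split; rewrite -(ler_pM2r (w_gt0 k.*2)) -mulrA -e.
    exact: (le_trans a1 b2).
  exact: (le_trans b1 a2).
have [r_lt1|r_gt1|//] := ltgtP r 1.
- have [k hkk] : exists k : nat, (1 - r)^-1 < k%:R.
    exists (Num.bound `|(1 - r)^-1|); apply: (le_lt_trans (ler_norm _)).
    exact: archi_boundP.
  have [_] := hk k; rewrite -natr1 => h.
  have e0 : 0 < 1 - r by rewrite subr_gt0.
  move: hkk; rewrite -(ltr_pM2r e0) mulVf ?gt_eqF// => hkk.
  have : k.*2%:R * (1 - r) <= r by lra.
  rewrite -muln2 natrM; lra.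
- have [k hkk] : exists k : nat, (r - 1)^-1 < k%:R.
    exists (Num.bound `|(r - 1)^-1|); apply: (le_lt_trans (ler_norm _)).
    exact: archi_boundP.
  have [] := hk k; rewrite -natr1 => h _.
  have e0 : 0 < r - 1 by rewrite subr_gt0.
  move: hkk; rewrite -(ltr_pM2r e0) mulVf ?gt_eqF// => hkk.
  have : k.*2%:R * (r - 1) <= 1 by lra.
  rewrite -muln2 natrM; lra.
Qed.

End wallis.

(** * Polynomials on [0, 1] converging to a step function *)

Section step_polynomials.
Variable R : realType.
Implicit Types (y z : R) (n N : nat).

Lemma bernoulli_ge (a : R) N : -1 <= a -> 1 + N%:R * a <= (1 + a) ^+ N.
Proof.
move=> a1; elim: N => [|N IH]; first by rewrite mul0r addr0 expr0.
rewrite exprS; apply: (@le_trans _ _ ((1 + a) * (1 + N%:R * a))).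
  rewrite -natr1 -subr_ge0 [leRHS](_ : _ = N%:R * a ^+ 2); last by ring.
  by rewrite mulr_ge0 ?sqr_ge0.
by rewrite ler_wpM2l// -lerBlDl sub0r.
Qed.

(* Tends to the indicator of y < 1/2 on [0, 1], including the value 0 at 1/2;
   the factor n in the exponent is what makes the limit there 0. *)
Definition step_seq n y : R := (1 - y ^+ n) ^+ (n * 2 ^ n).

Lemma step_seq_ge0 n y : 0 <= y <= 1 -> 0 <= step_seq n y.
Proof. by move=> /andP[y0 y1]; rewrite exprn_ge0// subr_ge0 exprn_ile1. Qed.

Lemma step_seq_le1 n y : 0 <= y <= 1 -> step_seq n y <= 1.
Proof.
move=> /andP[y0 y1]; rewrite exprn_ile1//; first by rewrite subr_ge0 exprn_ile1.
by rewrite lerBlDr lerDl exprn_ge0.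
Qed.

(** Bernoulli's inequality at -y^n; the lower bound tends to 1 when y < 1/2. *)
Lemma step_seq_ge n y : 0 <= y <= 1 -> 1 - n%:R * (2 * y) ^+ n <= step_seq n y.
Proof.
move=> /andP[y0 y1]; rewrite /step_seq.
apply: le_trans (@bernoulli_ge (- y ^+ n) (n * 2 ^ n) _); last first.
  by rewrite lerN2 exprn_ile1.
by rewrite natrM natrX exprMn mulrN mulrA.
Qed.

(** Since 2y >= 1, Bernoulli gives 1 + n <= 1 + n (2y)^n <= (1 + y^n)^(n 2^n). Multiplying by
    [step_seq n y] leaves a power of 1 - y^(2n), which is at most 1. *)
Lemma step_seq_le n y : 2^-1 <= y <= 1 -> step_seq n y <= (1 + n%:R)^-1.
Proof.
move=> /andP[y2 y1]; have y0 : 0 <= y by apply: le_trans y2; rewrite invr_ge0.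
have yn1 : y ^+ n <= 1 by exact: exprn_ile1.
have n0 : 0 < 1 + n%:R :> R by rewrite ltr_pwDl.
rewrite -[leRHS]mul1r ler_pdivlMr//.
apply: (@le_trans _ _ (step_seq n y * (1 + (n * 2 ^ n)%:R * y ^+ n))).
  rewrite ler_wpM2l ?step_seq_ge0 ?y0// lerD2l natrM natrX -mulrA -exprMn.
  rewrite ler_peMr// exprn_ege1//.
  lra.
apply: (@le_trans _ _ (step_seq n y * (1 + y ^+ n) ^+ (n * 2 ^ n))).
  rewrite ler_wpM2l ?step_seq_ge0 ?y0// bernoulli_ge//.
  by apply: (@le_trans _ _ 0); rewrite ?lerN10 ?exprn_ge0.
rewrite /step_seq -exprMn exprn_ile1//.
  by rewrite mulr_ge0 ?subr_ge0// addr_ge0 ?exprn_ge0.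
have -> : (1 - y ^+ n) * (1 + y ^+ n) = 1 - (y ^+ n) ^+ 2 by ring.
by rewrite lerBlDr lerDl sqr_ge0.
Qed.

(** With z = w^2, the factor n w^n is bounded by 1 / (1 - w), and the other factor w^n tends to
    0. *)
Lemma cvg_natr_mul_exprn z : 0 <= z < 1 -> n%:R * z ^+ n @[n --> \oo] --> (0 : R).
Proof.
move=> /andP[z0 z1].
pose w := Num.sqrt z.
have w0 : 0 <= w by exact: sqrtr_ge0.
have w1 : w < 1 by rewrite -sqrtr1 ltr_sqrt.
have nw n : n%:R * w ^+ n <= (1 - w)^-1.
  have d0 : 0 < 1 - w by rewrite subr_gt0.
  rewrite -[leRHS]mul1r ler_pdivlMr//.
  (* This says that each of the n terms of the geometric sum 1 + w + ... + w^(n-1) is at least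
     w^n. *)
  suff : n%:R * w ^+ n * (1 - w) <= 1 - w ^+ n.
    by move/le_trans; apply; rewrite lerBlDr lerDl exprn_ge0.
  elim: n => [|n IH]; first by rewrite !mul0r expr0 subrr.
  have wn1 : w ^+ n.+1 <= 1 by rewrite exprn_ile1// ltW.
  have : 0 <= (1 - w) * (1 - w ^+ n.+1) by rewrite mulr_ge0 ?subr_ge0// ltW.
  have := ler_wpM2l w0 IH.
  by rewrite -natr1 exprS; lra.
apply: (@squeeze_cvgr _ _ _ _ (fun=> 0) (fun n => (1 - w)^-1 * w ^+ n)).
- apply: nearW => n; rewrite mulr_ge0 ?exprn_ge0//=.
  have -> : z = w * w by rewrite -expr2 sqr_sqrtr.
  rewrite exprMn mulrA.
  by rewrite ler_wpM2r ?exprn_ge0.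
- exact: cvg_cst.
- rewrite -(mulr0 (1 - w)^-1); apply: cvgMr.
  by apply: cvg_expr; rewrite ger0_norm.
Qed.

Lemma cvg_step_seq y : 0 <= y <= 1 ->
  step_seq n y @[n --> \oo] --> ((y < 2^-1)%R%:R : R).
Proof.
move=> y01; have [y2|y2] := ltrP y 2^-1.
  apply: (@squeeze_cvgr _ _ _ _ (fun n => 1 - n%:R * (2 * y) ^+ n) (fun=> 1)).
  - by apply: nearW => n; rewrite step_seq_ge// step_seq_le1.
  - rewrite -[X in _ --> X]subr0; apply: cvgB; first exact: cvg_cst.
    apply: cvg_natr_mul_exprn; case/andP: y01 => y0 _.
    apply/andP; split; lra.
  - exact: cvg_cst.
apply: (@squeeze_cvgr _ _ _ _ (fun=> 0) (fun n => (1 + n%:R)^-1)).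
- apply: nearW => n; rewrite step_seq_ge0//= step_seq_le// y2.
  by case/andP: y01.
- exact: cvg_cst.
- under eq_fun do rewrite addrC natr1.
  exact: cvg_harmonic.
Qed.

End step_polynomials.

(** * Moments determine a law with bounded support *)

Section moment_determinacy.
Variable R : realType.
Implicit Types (P Q : probability (measurableTypeR R) R) (f g : R -> R).

Section bounded_support.
Variables (P : probability (measurableTypeR R) R) (L : R).
Hypothesis PL : P (~` `[- L, L]) = 0%E.

Lemma bounded_support_integrable f : continuous f ->
  P.-integrable [set: measurableTypeR R] (EFin \o f).
Proof.
move=> cf.
have mf : measurable_fun [set: measurableTypeR R] f by exact: continuous_measurable_fun.
have mE : measurable (`[- L, L]%classic : set (measurableTypeR R)) by [].
apply/integrableP; split; first exact/measurable_EFinP.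
rewrite (ge0_negligible_integral _ _ _ _ PL)//; last 2 first.
- exact: measurableC.
- by apply: measurableT_comp => //; exact/measurable_EFinP.
rewrite setTD setCK.
have /integrableP[//] : P.-integrable `[- L, L] (EFin \o f).
apply: measurable_bounded_integrable => //.
- by rewrite (le_lt_trans (probability_le1 _ _))// ltry.
- exact: measurable_funTS.
- have : compact (f @` `[- L, L]).
    apply: continuous_compact; first exact: continuous_subspaceT.
    exact: segment_compact.
  move=> /compact_bounded [M [Mr hM]]; exists M; split=> // x /hM h y yL.
  by apply: h; exists y.
Qed.

Lemma bounded_support_integralE f : continuous f ->
  (\int[P]_x (f x)%:E = \int[P]_(x in `[(- L)%R, L]) (f x)%:E)%E.
Proof.
move=> cf; rewrite (negligible_integral _ _ _ PL)//.
- by rewrite setTD setCK.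
- exact: measurableC.
- exact: bounded_support_integrable.
Qed.

Lemma bounded_support_poly (p : {poly R}) :
  \int[P]_x p.[x] = \sum_(i < size p) p`_i * \int[P]_x (x ^+ i).
Proof.
under eq_Rintegral do rewrite horner_coef.
elim: (size p) => [|n IH].
  by under eq_Rintegral do rewrite big_ord0; rewrite big_ord0 Rintegral_cst// mul0r.
under eq_Rintegral do rewrite big_ord_recr/=.
have cs : continuous (fun x : R => \sum_(i < n) p`_i * x ^+ i).
  move=> x; apply: continuous_big => [|i _]; first exact: add_continuous.
  exact: (cont_mul (@cont_cst R p`_i) (@exprn_continuous R i)).
have cx : continuous (fun x : R => x ^+ n) by exact: exprn_continuous.
have cpx : continuous (fun x : R => p`_n * x ^+ n).
  exact: (cont_mul (@cont_cst R p`_n) cx).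
rewrite RintegralD//; [|exact: bounded_support_integrable..].
by rewrite IH RintegralZl//; [rewrite big_ord_recr|exact: bounded_support_integrable].
Qed.

(** [step_seq] after the decreasing affine map from [a - K, a + K] onto [0, 1]; it sends a to 1/2,
    hence t > a to y < 1/2. *)
Definition step_poly (K a : R) n : {poly R} :=
  (1 - (2^-1%:P - (2 * K)^-1%:P * ('X - a%:P)) ^+ n) ^+ (n * 2 ^ n).

Lemma horner_step_poly (K a t : R) n :
  (step_poly K a n).[t] = step_seq n (2^-1 - (2 * K)^-1 * (t - a)).
Proof. by rewrite /step_poly /step_seq !hornerE. Qed.

(** Dominated convergence with bound 1. The condition on K puts the support [-L, L] inside
    [a - K, a + K], where the polynomials take values in [0, 1]. *)
Lemma step_poly_cvg (K a : R) : 0 < K -> `|a| + L <= K ->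
  (\int[P]_x (step_poly K a n).[x]%:E @[n --> \oo] --> P (`]a, +oo[%classic))%E.
Proof.
move=> K0 aLK.
have mE : measurable (`[- L, L]%classic : set (measurableTypeR R)) by [].
have cp (p : {poly R}) : continuous (fun x => p.[x]) by exact: continuous_horner.
under eq_fun do rewrite bounded_support_integralE//.
have -> : P (`]a, +oo[%classic) =
    (\int[P]_(x in `[(- L)%R, L]) (\1_(`]a, +oo[%classic) x)%:E)%E.
  rewrite integral_indic// (measureDI P _ mE)//.
  have mD : measurable
      (`]a, +oo[%classic `\` `[- L, L]%classic : set (measurableTypeR R)).
    exact: measurableD.
  have sD : `]a, +oo[%classic `\` `[- L, L]%classic `<=` ~` `[- L, L]%classic.
    by move=> x [].
  rewrite [X in (X + _)%E](_ : _ = 0%E) ?add0e//.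
  exact: (subset_measure0 mD (measurableC mE) sD PL).
have y01 t : `[- L, L]%classic t -> 0 <= 2^-1 - (2 * K)^-1 * (t - a) <= 1.
  rewrite /= in_itv/= => /andP[Lt tL].
  have /ler_normlP[h1 h2] : `|t - a| <= K.
    rewrite (le_trans _ aLK)// (le_trans (ler_normB _ _))// addrC lerD2l.
    by rewrite ler_norml Lt.
  rewrite invfM.
  have : K^-1 * (t - a) <= 1 by rewrite ler_pdivrMl ?mulr1//; lra.
  have : -1 <= K^-1 * (t - a) by rewrite ler_pdivlMl// mulrN1; lra.
  by move=> *; apply/andP; split; lra.
apply: (@dominated_cvg _ _ _ P _ mE (fun n x => (step_poly K a n).[x]%:E) _ (fun=> 1%E)).
- move=> n; apply/measurable_EFinP/measurable_funTS.
  exact: continuous_measurable_fun.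
- move=> t tL; apply/fine_cvgP; split; first by near=> n.
  under eq_cvg do rewrite /= horner_step_poly.
  have := @cvg_step_seq _ _ (y01 t tL).
  rewrite [X in _ --> X](_ : _ = \1_(`]a, +oo[%classic) t)//.
  rewrite indicE mem_setE/= in_itv/= andbT; congr (_%:R).
  have K20 : 0 < (2 * K)^-1 by rewrite invr_gt0 mulr_gt0.
  by rewrite ltrBlDr -subr_gt0 (addrC 2^-1) addrK pmulr_rgt0// subr_gt0.
- by [].
- by apply/integrableP; split => //; rewrite integral_cst//= normr1 mul1e
    (le_lt_trans (probability_le1 _ _))// ltry.
- move=> n t tL; rewrite lee_fin horner_step_poly ger0_norm ?step_seq_ge0 ?y01//.
  by rewrite step_seq_le1// y01.
Unshelve. all: by end_near. Qed.

End bounded_support.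

(** Integrals of polynomials depend only on the moments, so in the limit P and Q agree on open rays,
    an intersection-stable generator of the Borel sets. *)
Lemma moments_determine P Q (L : R) :
  P (~` `[- L, L]) = 0%E -> Q (~` `[- L, L]) = 0%E ->
  (forall m, \int[P]_t (t ^+ m) = \int[Q]_t (t ^+ m)) ->
  forall A, measurable A -> P A = Q A.
Proof.
move=> PL QL mPQ A mA.
have ray a : P `]a, +oo[%classic = Q `]a, +oo[%classic.
  have K0 : 0 < `|a| + `|L| + 1 by rewrite ltr_wpDl ?addr_ge0.
  have aLK : `|a| + L <= `|a| + `|L| + 1.
    by rewrite -addrA lerD2l ler_wpDr// ler_norm.
  have hP := step_poly_cvg PL K0 aLK; have hQ := step_poly_cvg QL K0 aLK.
  rewrite -(cvg_lim _ hP)// -(cvg_lim _ hQ)//.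
  apply: congr_lim; apply/funext => n.
  have cp : continuous (fun x => (step_poly (`|a| + `|L| + 1) a n).[x]).
    exact: continuous_horner.
  have fP := integrable_fin_num measurableT (bounded_support_integrable PL cp).
  have fQ := integrable_fin_num measurableT (bounded_support_integrable QL cp).
  rewrite -(fineK fP) -(fineK fQ); congr EFin.
  rewrite -!/(Rintegral _ _ _) (bounded_support_poly PL) (bounded_support_poly QL).
  by apply: eq_bigr => i _; rewrite mPQ.
pose G := @RGenOInfty.G R.
apply: (@measure_unique _ _ (measurableTypeR R) G
  (fun k => `](- k%:R), +oo[%classic)) => //.
- exact: RGenOInfty.measurableE.
- move=> _ _ [x ->] [y ->]; exists (Num.max x y).
  by apply/seteqP; split => z /=; rewrite !in_itv/= !andbT gt_max => /andP.
- by move=> k; exists (- k%:R).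
- apply/seteqP; split => // x _; exists (Num.bound `|x : R|) => //=.
  rewrite in_itv/= andbT ltrNl (le_lt_trans (ler_norm _))// normrN.
  exact: (archi_boundP (normr_ge0 (x : R))).
- by move=> _ [x ->]; exact: ray.
- by move=> k; rewrite (le_lt_trans (probability_le1 _ _))// ltry.
Qed.

End moment_determinacy.

(** * The probability measure with a given density *)

Section density_prob.
Variable R : realType.
Local Notation mu := (@lebesgue_measure R).
Variable f : measurableTypeR R -> \bar R.
Hypothesis mf : measurable_fun [set: measurableTypeR R] f.
Hypothesis f0 : forall x, (0 <= f x)%E.
Hypothesis f1 : (\int[mu]_x f x = 1)%E.

(** The proofs are arguments of the term so that the measure and probability structures declared
    below can be inferred from it. *)
Definition density_prob (_ : measurable_fun [set: measurableTypeR R] f)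
  (_ : forall x, (0 <= f x)%E) (_ : (\int[mu]_x f x = 1)%E)
  (A : set (measurableTypeR R)) : \bar R := (\int[mu]_(x in A) f x)%E.

Local Notation P := (density_prob mf f0 f1).

Let density_prob0 : P set0 = 0%E.
Proof. exact: integral_set0. Qed.

Let density_prob_ge0 A : (0 <= P A)%E.
Proof. exact: integral_ge0. Qed.

Let density_prob_sigma_additive : semi_sigma_additive P.
Proof.
move=> /= F mF tF mUF; rewrite /density_prob; apply: cvg_toP.
  apply: ereal_nondecreasing_is_cvgn => m n mn.
  by apply: lee_sum_nneg_natr => // k _ _; exact: integral_ge0.
by rewrite ge0_integral_bigcup//=; exact: measurable_funTS.
Qed.

HB.instance Definition _ := isMeasure.Build _ _ _ P
  density_prob0 density_prob_ge0 density_prob_sigma_additive.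

HB.instance Definition _ := @Measure_isProbability.Build _ _ R P f1.

Lemma density_prob_dominates : P `<< mu.
Proof.
apply/null_content_dominatesP => A mA muA.
by rewrite /density_prob null_set_integral//; exact: measurable_funTS.
Qed.

(** The Radon-Nikodym derivative of P has the same integral as f over every measurable set, hence
    equals f almost everywhere. *)
Lemma integral_density_prob (g : measurableTypeR R -> \bar R) :
  P.-integrable setT g -> (\int[P]_x g x = \int[mu]_x (g x * f x))%E.
Proof.
move=> ig; rewrite -(Radon_Nikodym_change_of_variables density_prob_dominates)//.
have mg := measurable_int _ ig.
have iRN := Radon_Nikodym_integrable (nu := charge_of_finite_measure P)
  density_prob_dominates.
have mRN := measurable_int _ iRN.
apply: ae_eq_integral => //; [exact: emeasurable_funM|exact: emeasurable_funM|].
apply: ae_eqe_mul2l; apply: integral_ae_eq => // A _ mA.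
rewrite -Radon_Nikodym_integral//.
exact: density_prob_dominates.
Qed.

End density_prob.

(** * The substitution y = 1 + 2 cos u in the arcsine density *)

Section arcsine.
Variable R : realType.
Local Notation mu := (@lebesgue_measure R).
Implicit Types (u y : R) (G : R -> R).

Definition arcsine_pdf y : R := (pi * Num.sqrt ((y + 1) * (3 - y)))^-1.

Definition shifted_cos u : R := 1 + 2 * cos u.

Lemma is_derive_shifted_cos u : is_derive u 1 shifted_cos (- (2 * sin u)).
Proof.
have h := is_derive_add (is_derive_cst (1 : R) u 1)
  (is_derive_mul (is_derive_cst (2 : R) u 1) (is_derive_cos u)).
by apply: (@is_derive_eq _ _ _ _ _ _ _ _ h); rewrite /cst/=; ring.
Qed.

Lemma continuous_shifted_cos : continuous shifted_cos.
Proof.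
exact (cont_add (@cont_cst R 1) (cont_mul (@cont_cst R 2) (@continuous_cos R))).
Qed.

Lemma arcsine_pdf_ge0 y : 0 <= arcsine_pdf y.
Proof. by rewrite invr_ge0 mulr_ge0 ?pi_ge0 ?sqrtr_ge0. Qed.

(** At y = 1 + 2 cos u the product (y + 1)(3 - y) is (2 sin u)^2, so the Jacobian cancels the
    root. *)
Lemma arcsine_pdf_cos u : 0 < u < pi ->
  arcsine_pdf (shifted_cos u) * (2 * sin u) = pi^-1.
Proof.
move=> u0pi; have s0 : 0 < sin u by exact: sin_gt0_pi.
rewrite /arcsine_pdf /shifted_cos.
have -> : (1 + 2 * cos u + 1) * (3 - (1 + 2 * cos u)) = (2 * sin u) ^+ 2.
  by have e := sin2cos2 u; ring: e.
rewrite sqrtr_sqr gtr0_norm ?mulr_gt0// invfM -mulrA mulVf ?mulr1//.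
by rewrite mulf_neq0// gt_eqF.
Qed.

Lemma measurable_arcsine_pdf : measurable_fun [set: R] arcsine_pdf.
Proof.
rewrite (_ : arcsine_pdf = fun y =>
    pi^-1 * (Num.sqrt ((y + 1) * (3 - y)) `^ (-1))); last first.
  by apply/funext => y; rewrite /arcsine_pdf invfM powR_inv1// sqrtr_ge0.
apply: measurable_funM => //.
apply: (@measurableT_comp _ _ _ _ _ _ (@powR R ^~ (-1))) => //.
have ms : measurable_fun [set: R] (@Num.sqrt R).
  by apply: continuous_measurable_fun; exact: sqrt_continuous.
apply: (measurableT_comp ms).
by apply: measurable_funM; [exact: measurable_funD|exact: measurable_funB].
Qed.

Lemma continuous_arcsine_pdf y : -1 < y < 3 -> {for y, continuous arcsine_pdf}.
Proof.
move=> /andP[y1 y3].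
have D0 : 0 < (y + 1) * (3 - y) by rewrite mulr_gt0 ?subr_gt0// -ltrBlDr sub0r.
have hD := is_derive_mul (is_derive_add (is_derive_id y 1) (is_derive_cst (1:R) y 1))
  (is_derive_add (is_derive_cst (3:R) y 1) (is_derive_opp (is_derive_id y 1))).
have h := is_derive_mul (is_derive_cst (pi^-1 : R) y 1)
  (@is_derive_inv_sqrt _ (fun y => (y + 1) * (3 - y)) _ _ D0 hD).
rewrite (_ : arcsine_pdf = fun y =>
    pi^-1 * (Num.sqrt ((y + 1) * (3 - y)))^-1); last first.
  by apply/funext => z; rewrite /arcsine_pdf invfM.
by apply/differentiable_continuous/derivable1_diffP; case: h.
Qed.

(** Staying strictly inside ]0, pi[ keeps the density continuous on the closed image interval. *)
Lemma arcsine_substitution_itv G (a b : R) : continuous G ->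
  0 < a -> a <= b -> b < pi ->
  (\int[mu]_(y in `[shifted_cos b, shifted_cos a]) (G y * arcsine_pdf y)%:E =
   \int[mu]_(u in `[a, b]) (G (shifted_cos u) / pi)%:E)%E.
Proof.
move=> cG a0 ab bpi.
have dF : derive1 shifted_cos = fun u => - (2 * sin u).
  by apply/funext => u; rewrite derive1E; case: (is_derive_shifted_cos u).
have cF' : continuous (fun u : R => - (2 * sin u)).
  rewrite (_ : (fun u : R => - (2 * sin u)) = (fun u => (- 2) * sin u)).
    exact (cont_mul (@cont_cst R (-2)) (@continuous_sin R)).
  by apply/funext => u; rewrite mulNr.
rewrite (@integration_by_substitution_decreasing _ shifted_cos
  (fun y => G y * arcsine_pdf y))//.
- apply: eq_integral => u; rewrite inE/= in_itv/= => /andP[au ub].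
  rewrite !fctE dF opprK -mulrA arcsine_pdf_cos//.
  by rewrite (lt_le_trans a0 au) (le_lt_trans ub bpi).
- move=> x y; rewrite !in_itv/= => /andP[ax xb] /andP[ay yb] xy.
  rewrite /shifted_cos ltrD2l ltr_pM2l// ltr_cos// in_itv/=; apply/andP; split; lra.
- by move=> u _; rewrite dF; exact: cF'.
- by apply/cvg_ex; exists (- (2 * sin a)); rewrite dF; exact/cvg_at_right_filter/cF'.
- by apply/cvg_ex; exists (- (2 * sin b)); rewrite dF; exact/cvg_at_left_filter/cF'.
- split; first by move=> u _; case: (is_derive_shifted_cos u).
  + exact/cvg_at_right_filter/continuous_shifted_cos.
  + exact/cvg_at_left_filter/continuous_shifted_cos.
- apply: continuous_in_subspaceT => y; rewrite inE/= in_itv/= => /andP[y1 y2].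
  apply: (@continuousM _ _ G arcsine_pdf); [exact: cG|apply: continuous_arcsine_pdf].
  have pi0 := @pi_gt0 R.
  have cb : -1 < cos b.
    by rewrite -cospi ltr_cos// ?in_itv/=; try (apply/andP; split); lra.
  have ca : cos a < 1.
    by rewrite -cos0 ltr_cos// in_itv/=; apply/andP; split; lra.
  move: y1 y2; rewrite /shifted_cos => y1 y2; apply/andP; split; lra.
Qed.

(** Exhausts ]0, pi[ by the intervals [1/(n+1), pi - 1/(n+1)] and passes to the limit by monotone
    convergence, for which G is nonnegative on [-1, 3]. *)
Lemma arcsine_substitution G : continuous G ->
  (forall y, -1 <= y <= 3 -> 0 <= G y) ->
  (\int[mu]_(y in `[(-1)%R, 3%R]) (G y * arcsine_pdf y)%:E =
   \int[mu]_(u in `[0%R, pi]) (G (shifted_cos u) / pi)%:E)%E.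
Proof.
move=> cG G0.
pose e n : R := n.+1%:R^-1.
have e0 n : 0 < e n by rewrite invr_gt0.
have e1 n : e n <= 1 by rewrite invf_le1// ler1n.
have pi2 := @pi_ge2 R.
have e_le n m : (n <= m)%N -> e m <= e n by move=> nm; rewrite lef_pV2 ?posrE// ler_nat.
have epi n : e n <= pi - e n by have := e1 n; lra.
have small (x : R) : 0 < x -> exists n, e n <= x.
  move=> x0; exists (Num.bound x^-1); rewrite -[leRHS]invrK lef_pV2 ?posrE ?invr_gt0//.
  apply: ltW; apply: lt_le_trans (archi_boundP _) _; first by rewrite invr_ge0 ltW.
  by rewrite ler_nat.
pose A n := `[e n, pi - e n]%classic.
pose B n := `[shifted_cos (pi - e n), shifted_cos (e n)]%classic.
have AB n : (\int[mu]_(y in B n) (G y * arcsine_pdf y)%:E =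
   \int[mu]_(u in A n) (G (shifted_cos u) / pi)%:E)%E.
  by apply: arcsine_substitution_itv => //; rewrite ltrBlDr ltrDl.
have AU : \bigcup_n A n = `]0, pi[%classic.
  apply/seteqP; split => u /=; rewrite /A ?in_itv/=.
    move=> [n _]; rewrite /= in_itv/= => /andP[h1 h2]; have := e0 n.
    by move=> h; apply/andP; split; lra.
  move=> /andP[u0 upi].
  have [n hn] := small (Num.min u (pi - u)) (ltac:(by rewrite lt_min u0 subr_gt0)).
  exists n => //=; rewrite in_itv/=; move: hn; rewrite le_min => /andP[-> h]/=.
  lra.
have mono (u v : R) : 0 <= u -> u <= v -> v <= pi -> shifted_cos v <= shifted_cos u.
  move=> u0 uv vpi; rewrite /shifted_cos lerD2l ler_pM2l//.
  move: uv; rewrite le_eqVlt => /predU1P[->//|uv].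
  by apply: ltW; rewrite ltr_cos// ?in_itv/=; try (apply/andP; split); lra.
have BU : \bigcup_n B n = `](-1), 3[%classic.
  apply/seteqP; split => y /=; rewrite /B ?in_itv/=.
    move=> [n _]; rewrite /= in_itv/= => /andP[h1 h2].
    have en0 := e0 n; have en1 := e1 n.
    have c1 : cos (e n) < 1 by rewrite -cos0 ltr_cos// in_itv/=; apply/andP; split; lra.
    have c2 : -1 < cos (pi - e n).
      by rewrite -cospi ltr_cos// ?in_itv/=; try (apply/andP; split); lra.
    by move: h1 h2; rewrite /shifted_cos => h1 h2; apply/andP; split; lra.
  move=> /andP[y1 y3].
  pose u := acos ((y - 1) / 2).
  have yu : y = shifted_cos u.
    rewrite /shifted_cos /u acosK; first by field.
    by rewrite in_itv/=; apply/andP; split; lra.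
  have u0 : 0 < u by apply: acos_gt0; apply/andP; split; lra.
  have upi : u < pi by apply: acos_ltpi; apply/andP; split; lra.
  have [n hn] := small (Num.min u (pi - u)) (ltac:(by rewrite lt_min u0 subr_gt0)).
  exists n => //=; rewrite in_itv/= yu; move: hn; rewrite le_min => /andP[h1 h2].
  have en0 := e0 n; have en1 := e1 n.
  by rewrite !mono//; lra.
have mGp : measurable_fun [set: R] (fun y => (G y * arcsine_pdf y)%:E).
  apply/measurable_EFinP; apply: measurable_funM; last exact: measurable_arcsine_pdf.
  exact: continuous_measurable_fun.
have mGc : measurable_fun [set: R] (fun u => (G (shifted_cos u) / pi)%:E).
  apply/measurable_EFinP; apply: measurable_funM => //.
  apply: continuous_measurable_fun => u.
  by apply: continuous_comp; [exact: continuous_shifted_cos|exact: cG].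
rewrite -integral_itv_obnd_cbnd; last exact: measurable_funTS.
rewrite -integral_itv_bndo_bndc; last exact: measurable_funTS.
rewrite -[RHS]integral_itv_obnd_cbnd; last exact: measurable_funTS.
rewrite -[RHS]integral_itv_bndo_bndc; last exact: measurable_funTS.
rewrite -AU -BU.
have hB : (\int[mu]_(y in B n) (G y * arcsine_pdf y)%:E @[n --> \oo] -->
    \int[mu]_(y in \bigcup_n B n) (G y * arcsine_pdf y)%:E)%E.
  apply: ge0_nondecreasing_set_cvg_integral.
  - move=> n m nm; apply/subsetPset => y; rewrite /B /= !in_itv/= => /andP[h1 h2].
    have h := e_le _ _ nm; have := e0 m; have := e1 n => *.
    rewrite (le_trans _ h1) ?(le_trans h2)// mono//; lra.
  - by move=> n; exact: measurable_itv.
  - by move=> n; exact: measurable_funTS.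
  - move=> n y By; rewrite lee_fin mulr_ge0 ?arcsine_pdf_ge0// G0//.
    have : (\bigcup_n B n) y by exists n.
    by rewrite BU /= in_itv/= => /andP[? ?]; rewrite !ltW.
have hA : (\int[mu]_(u in A n) (G (shifted_cos u) / pi)%:E @[n --> \oo] -->
    \int[mu]_(u in \bigcup_n A n) (G (shifted_cos u) / pi)%:E)%E.
  apply: ge0_nondecreasing_set_cvg_integral.
  - move=> n m nm; apply/subsetPset => y; rewrite /A /= !in_itv/= => /andP[h1 h2].
    by have h := e_le _ _ nm; apply/andP; split; lra.
  - by move=> n; exact: measurable_itv.
  - by move=> n; exact: measurable_funTS.
  - move=> n y Ay; rewrite lee_fin divr_ge0 ?pi_ge0// G0//.
    have := cos_le1 y; have := cos_geN1 y; rewrite /shifted_cos => *.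
    by apply/andP; split; lra.
rewrite -(cvg_lim _ hA)// -(cvg_lim _ hB)//.
by apply: congr_lim; apply/funext => n; rewrite AB.
Qed.

End arcsine.

(** * Cosine coefficients of powers of a + 2 cos u *)

Section trigonometric_moments.
Variable R : realType.
Local Notation mu := (@lebesgue_measure R).
Implicit Types (a u : R) (k : int) (n : nat).

(** The coefficient of z^k in (a + z + z^-1)^n: it counts n-step walks on Z from k to 0, with a
    weight a for each rest. *)
Definition trigmom a n k : R :=
  pi^-1 * \int[mu]_(u in `[0, pi]) ((a + 2 * cos u) ^+ n * cos (k%:~R * u)).

Lemma sin_int_pi k : sin (k%:~R * pi) = 0 :> R.
Proof.
have sn n : sin (n%:R * pi) = 0 :> R.
  elim: n => [|n IH]; first by rewrite mul0r sin0.
  by rewrite -natr1 mulrDl mul1r sinDpi IH oppr0.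
case: k => n; first exact: sn.
by rewrite NegzE mulrNz mulNr sinN sn oppr0.
Qed.

Lemma continuous_cos_scale (c : R) : continuous (fun u : R => cos (c * u)).
Proof.
move=> u; apply: (@continuous_comp _ _ _ (fun u => c * u) cos).
  exact: (cont_mul (@cont_cst R c) (@exprn_continuous R 1)).
exact: continuous_cos.
Qed.

Lemma continuous_trig_pow a n : continuous (fun u : R => (a + 2 * cos u) ^+ n).
Proof.
apply: cont_exp.
exact (cont_add (@cont_cst R a) (cont_mul (@cont_cst R 2) (@continuous_cos R))).
Qed.

Lemma continuous_trigmom a n (c : R) :
  continuous (fun u : R => (a + 2 * cos u) ^+ n * cos (c * u)).
Proof.
exact (cont_mul (@continuous_trig_pow a n) (@continuous_cos_scale c)).
Qed.

Lemma trigmom0 a k : trigmom a 0 k = (k == 0)%:R.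
Proof.
rewrite /trigmom; under eq_Rintegral do rewrite expr0 mul1r.
have [->|k0] := eqVneq k 0.
  under eq_Rintegral do rewrite mul0r cos0.
  by rewrite Rintegral_cst_0pi mul1r mulVf// gt_eqF// pi_gt0.
have kR0 : k%:~R != 0 :> R by rewrite intr_eq0.
have dF (u : R) : is_derive u 1 (fun u : R => k%:~R^-1 * sin (k%:~R * u))
    (cos (k%:~R * u)).
  have hk : is_derive u 1 (fun u : R => k%:~R * u) k%:~R.
    have h := is_derive_mul (is_derive_cst (k%:~R : R) u 1) (is_derive_id u 1).
    by apply: (@is_derive_eq _ _ _ _ _ _ _ _ h); rewrite /cst/=; ring.
  have h := is_derive_mul (is_derive_cst (k%:~R^-1 : R) u 1)
    (@is_derive1_comp _ sin (fun u : R => k%:~R * u) _ _ _ (is_derive_sin _) hk).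
  by apply: (@is_derive_eq _ _ _ _ _ _ _ _ h); rewrite /cst/=; field.
rewrite (Rintegral_FTC (pi_gt0 R) dF); last exact: continuous_cos_scale.
by rewrite sin_int_pi !mulr0 sin0 !mulr0 subrr mulr0.
Qed.

(** Follows from 2 cos u cos(k u) = cos((k + 1) u) + cos((k - 1) u). *)
Lemma trigmomS a n k :
  trigmom a n.+1 k = a * trigmom a n k + trigmom a n (k + 1) + trigmom a n (k - 1).
Proof.
rewrite /trigmom; have c (z : R) := @continuous_trigmom a n z.
transitivity (pi^-1 * \int[mu]_(u in `[0, pi])
  (a * ((a + 2 * cos u) ^+ n * cos (k%:~R * u))
   + (a + 2 * cos u) ^+ n * cos ((k + 1)%:~R * u)
   + (a + 2 * cos u) ^+ n * cos ((k - 1)%:~R * u))).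
  congr (_ * _); apply: eq_Rintegral => u _.
  have -> : (k + 1)%:~R * u = k%:~R * u + u by rewrite intrD; ring.
  have -> : (k - 1)%:~R * u = k%:~R * u - u by rewrite intrB; ring.
  by rewrite exprS cosD cosB; ring.
have ca := cont_mul (@cont_cst R a) (c k%:~R).
have c1 := c (k + 1)%:~R; have c2 := c (k - 1)%:~R; have c0 := c k%:~R.
rewrite (RintegralD_cont _ _ (cont_add ca c1) c2).
rewrite (RintegralD_cont _ _ ca c1) (RintegralZ_cont _ _ _ c0).
by ring.
Qed.

Lemma trigmom_zero a n :
  trigmom a n 0 = pi^-1 * \int[mu]_(u in `[0, pi]) (a + 2 * cos u) ^+ n.
Proof.
by rewrite /trigmom; under eq_Rintegral do rewrite mul0r cos0 mulr1.
Qed.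

Lemma trigmom_cosint n : trigmom 0 n 0 = 2 ^+ n * cosint R n / pi.
Proof.
rewrite trigmom_zero; under eq_Rintegral do rewrite add0r exprMn.
rewrite RintegralZ_cont; last by apply: cont_exp; exact: continuous_cos.
by rewrite /cosint mulrC.
Qed.

End trigonometric_moments.

(** * The arcsine law on [-1, 3] and its moments *)

Section law2.
Variable R : realType.
Local Notation mu := (@lebesgue_measure R).

Lemma measurable_itv_restrict (a b : R) (f : R -> \bar R) :
  measurable_fun `[a, b] f -> measurable_fun [set: measurableTypeR R] (f \_ `[a, b]).
Proof. by move=> mf; apply: (iffLR (measurable_restrictT f _)). Qed.

Lemma bounded_support_addc (P : probability (measurableTypeR R) R) (L c : R)
    (f : R -> R) :
  P (~` `[- L, L]) = 0%E -> continuous f ->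
  \int[P]_x (f x + c) = \int[P]_x f x + c.
Proof.
move=> PL cf; have i1 := bounded_support_integrable PL cf.
have i2 := bounded_support_integrable PL (@cont_cst R c).
rewrite RintegralD// Rintegral_cst//. 
congr (_ + _); rewrite -[RHS]mulr1; congr (_ * _).
by rewrite -[1]/(fine 1%E); congr fine; exact: probability_setT.
Qed.

Lemma law_rho2 : exists P : probability (measurableTypeR R) R,
  [/\ forall A, measurable A ->
        P A = (\int[mu]_(y in A `&` `[(-1)%R, 3%R]) density_rho2 y)%E,
      P (~` `[- 4, 4]) = 0%E &
      forall m, \int[P]_t (t ^+ m) = trigmom 1 m 0].
Proof.
have pi0 := @pi_gt0 R.
pose f := @density_rho2 R \_ `[(-1)%R, 3%R].
have mf : measurable_fun [set: measurableTypeR R] f.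
  apply: measurable_itv_restrict; apply: measurable_funTS.
  have h : measurable_fun [set: R] (EFin \o @arcsine_pdf R).
    by apply/measurable_EFinP; exact: measurable_arcsine_pdf.
  exact: h.
have f0 x : (0 <= f x)%E.
  by rewrite /f patchE; case: ifP => // _; rewrite lee_fin arcsine_pdf_ge0.
have If (G : R -> R) : continuous G -> (forall y, -1 <= y <= 3 -> 0 <= G y) ->
   (\int[mu]_x ((G x)%:E * f x) =
    (pi^-1 * \int[mu]_(u in `[0, pi]) G (shifted_cos u))%:E)%E.
  move=> cG G0.
  have cGc : continuous (fun u => G (shifted_cos u)).
    by move=> u; apply: continuous_comp; [exact: continuous_shifted_cos|exact: cG].
  transitivity (\int[mu]_(y in `[(-1)%R, 3%R]) (G y * arcsine_pdf y)%:E)%E.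
    rewrite [RHS]integral_mkcond; apply: eq_integral => x _.
    by rewrite /f !patchE; case: ifP => // _; rewrite mule0.
  rewrite arcsine_substitution//; under eq_integral do rewrite mulrC EFinM.
  rewrite integralZl//; last exact: integrable_cont.
  rewrite EFinM; congr (_ * _)%E; rewrite /Rintegral fineK//.
  by apply: integrable_fin_num => //; exact: integrable_cont.
have f1 : (\int[mu]_x f x = 1)%E.
  have := If (fun=> 1) (@cont_cst R 1) (fun _ _ => ler01).
  under eq_integral do rewrite mul1e.
  by move=> ->; rewrite Rintegral_cst_0pi mul1r mulVf// gt_eqF.
pose P : probability (measurableTypeR R) R := density_prob mf f0 f1.
have PE A : measurable A ->
    P A = (\int[mu]_(y in A `&` `[(-1)%R, 3%R]) density_rho2 y)%E.
  by move=> mA; rewrite integral_mkcondr.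
have P4 : P (~` `[- 4, 4]) = 0%E.
  rewrite PE; last exact: measurableC.
  rewrite (_ : _ `&` _ = set0) ?integral_set0//.
  apply/seteqP; split => // y [/=]; rewrite !in_itv/= => h /andP[h1 h2].
  by apply: h; apply/andP; split; lra.
exists P; split => // m.
have cm : continuous (fun x : R => x ^+ m) by exact: exprn_continuous.
have c4 : continuous (fun _ : R => (4 : R) ^+ m) by exact: cont_cst.
have cm4 : continuous (fun x : R => x ^+ m + 4 ^+ m) by exact: (cont_add cm c4).
(* Odd powers are negative on part of [-1, 3]. Adding 4^m makes the integrand nonnegative as the
   substitution requires, and the constant cancels at the end. *)
have G0 (y : R) : -1 <= y <= 3 -> 0 <= y ^+ m + 4 ^+ m.
  move=> /andP[y1 y3]; rewrite -lerBlDr sub0r.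
  have h : `|y ^+ m| <= 4 ^+ m.
    rewrite normrX; apply: lerXn2r; rewrite ?nnegrE//.
    by rewrite ler_norml; apply/andP; split; lra.
  by move: h; rewrite ler_norml => /andP[].
have := If _ cm4 G0.
rewrite -(integral_density_prob (bounded_support_integrable P4 cm4)).
move=> /(congr1 fine)/=; rewrite -/(Rintegral _ _ _).
rewrite (bounded_support_addc _ P4 cm).
rewrite RintegralD_cont; last 2 first.
- exact: (@continuous_trig_pow R 1 m).
- exact: cont_cst.
rewrite Rintegral_cst_0pi mulrDr mulrCA mulVf ?gt_eqF// mulr1 => /addIr ->.
by rewrite trigmom_zero.
Qed.

End law2.

(** * Invariance under negation and odd moments *)

Section reflection.
Variable R : realType.
Local Notation mu := (@lebesgue_measure R).

Local Notation opp := (-%R : measurableTypeR R -> measurableTypeR R).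

Lemma measurable_oppR : measurable_fun [set: measurableTypeR R] opp.
Proof. exact: oppr_measurable. Qed.

(** By uniqueness of Lebesgue measure it suffices that negation turns ]a, b] into [-b, -a[, of the
    same length. *)
Lemma lebesgue_measure_oppr (A : set (measurableTypeR R)) : measurable A ->
  mu A = mu (-%R @^-1` A).
Proof.
move=> mA.
apply: (lebesgue_measure_unique (mu := pushforward mu opp)) mA.
move=> _ [[a b] _ <-] /=; rewrite /pushforward.
rewrite (_ : _ @^-1` _ = `[- b, - a[%classic); last first.
  apply/seteqP; split => x /=; rewrite !in_itv/= => /andP[h1 h2].
    by apply/andP; split; lra.
  by apply/andP; split; lra.
rewrite !lebesgue_measure_itv/= !lte_fin ltrN2.
by case: ifP => _; rewrite ?opprK 1?addeC.
Qed.

Lemma ge0_integral_oppr (h : measurableTypeR R -> \bar R) :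
  measurable_fun [set: measurableTypeR R] h -> (forall x, 0 <= h x)%E ->
  (\int[mu]_x h (- x)%R = \int[mu]_x h x)%E.
Proof.
move=> mh h0.
have := @ge0_integral_pushforward _ _ _ _ R opp measurable_oppR mu setT h
  measurableT mh (fun x _ => h0 x).
rewrite preimage_setT => <-.
apply: eq_measure_integral => A mA _; exact/esym/lebesgue_measure_oppr.
Qed.

(** Pushing P forward along negation shows that the moment, which is finite, equals its own
    opposite. *)
Lemma odd_moment_eq0 (P : probability (measurableTypeR R) R) (m : nat) :
  (forall A : set (measurableTypeR R), measurable A -> P (-%R @^-1` A) = P A) ->
  P.-integrable [set: measurableTypeR R] (fun x => (x ^+ m)%:E) -> odd m ->
  \int[P]_t (t ^+ m) = 0.
Proof.
move=> Popp im om.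
pose g (x : measurableTypeR R) : \bar R := (x ^+ m)%:E.
have gN : g \o -%R = (fun x => - g x)%E.
  by apply/funext => x; rewrite /g /= exprNn -signr_odd om expr1 mulN1r EFinN.
have mg : measurable_fun setT g := measurable_int _ im.
have igN : P.-integrable setT (g \o opp).
  by rewrite gN; exact: integrableN.
have := @integral_pushforward _ _ _ _ R opp measurable_oppR P setT g mg igN measurableT.
rewrite preimage_setT gN integralN//; last first.
  apply: fin_num_adde_defr; apply: integrable_fin_num => //.
  exact: integrable_funepos.
rewrite (eq_measure_integral P); last by move=> A mA _; exact: Popp.
rewrite /Rintegral -/g; have := integrable_fin_num measurableT im; rewrite -/g.
by case: (integral _ _ _) => // r _ /= [rN]; lra.
Qed.

End reflection.

(** * The elliptic law on [-4, 4] and its moments *)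

Section law1.
Variable R : realType.
Local Notation mu := (@lebesgue_measure R).

Lemma density_rho1E (x : R) : density_rho1 x =
  ((2 * pi ^+ 2)^-1%:E * \int[mu]_(t in `[0%R, (pi / 2)%R]) (ellf x t)%:E)%E.
Proof. by rewrite /density_rho1 ellipticK_ellf. Qed.

Lemma elliptic_moments m : ~~ odd m ->
  iint (@momM R m) = (2 * 4 ^+ m * wallis R m ^+ 2)%:E.
Proof.
move=> em; have [M [M1 M2 M3]] := elliptic_moment_recursion R.
by rewrite M1// (recursion_eq_wallis M2 M3).
Qed.

Lemma law_rho1 : exists P : probability (measurableTypeR R) R,
  [/\ forall A, measurable A ->
        P A = (\int[mu]_(x in A `&` `[(-4)%R, 4%R]) density_rho1 x)%E,
      P (~` `[- 4, 4]) = 0%E &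
      forall m, \int[P]_t (t ^+ m) = trigmom 0 m 0 ^+ 2].
Proof.
have pi0 := @pi_gt0 R.
pose f := @density_rho1 R \_ `[(-4)%R, 4%R].
pose c : R := (2 * pi ^+ 2)^-1.
have c0 : 0 <= c by rewrite invr_ge0 mulr_ge0 ?sqr_ge0.
pose K (x : R) := (\int[mu]_(t in `[0%R, (pi / 2)%R]) (ellf x t)%:E)%E.
have K0 x : (0 <= K x)%E.
  by apply: integral_ge0 => t _; rewrite lee_fin ellf_ge0.
have mK : measurable_fun `[(-4 : R), 4] K.
  have h := nneg_measurable2_iint (@nneg_momM R 0 isT).
  apply: eq_measurable_fun h => x _; apply: eq_integral => t _.
  by rewrite /momM expr0 mul1r.
have fE x : f x = (c%:E * (K \_ `[(-4)%R, 4%R]) x)%E.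
  by rewrite /f !patchE; case: ifP => _; rewrite ?mule0// density_rho1E.
have mKr : measurable_fun [set: measurableTypeR R] (K \_ `[(-4)%R, 4%R]).
  exact: measurable_itv_restrict.
have mf : measurable_fun [set: measurableTypeR R] f.
  rewrite (_ : f = (fun x => c%:E * (K \_ `[(-4)%R, 4%R]) x)%E); last exact/funext.
  exact: measurable_funeM.
have f0 x : (0 <= f x)%E.
  rewrite fE mule_ge0//.
  by rewrite patchE; case: ifP.
(* With c = 1 / (2 pi^2), the elliptic moment gives c 2 4^m W_m^2 = (2^m W_m / pi)^2. *)
have If m : ~~ odd m ->
   (\int[mu]_x ((x ^+ m)%:E * f x) = (trigmom 0 m 0 ^+ 2)%:E)%E.
  move=> em.
  transitivity (c%:E * iint (@momM R m))%E; last first.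
    rewrite elliptic_moments// -EFinM trigmom_cosint cosint_wallis// /c; congr EFin.
    have -> : 4 = 2 ^+ 2 :> R by ring.
    rewrite -exprM mulnC exprM; have pn0 : pi != 0 :> R by rewrite gt_eqF.
    by move: (2 ^+ m) (wallis R m) (pi : R) pn0 => p w q q0; field.
  have mm := nneg_measurable2_iint (@nneg_momM R m em).
  rewrite /iint -ge0_integralZl//; last first.
    move=> x _; apply: integral_ge0 => t _; rewrite lee_fin.
    by apply (@nneg_momM R m em).
  rewrite [RHS]integral_mkcond; apply: eq_integral => x _.
  rewrite fE !patchE; case: ifPn => _; last by rewrite !mule0.
  rewrite muleCA; congr (_ * _)%E; rewrite /momM.
  under [RHS]eq_integral do rewrite EFinM.
  rewrite ge0_integralZl//.
  - apply: measurable_funTS; have h := nneg_measurable2_x x (@nneg_momM R 0 isT).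
    by apply: eq_measurable_fun h => t _; rewrite /momM expr0 mul1r.
  - by move=> t _; rewrite lee_fin ellf_ge0.
  - by rewrite lee_fin exprn_even_ge0.
(* The total mass is the moment of order 0. *)
have f1 : (\int[mu]_x f x = 1)%E.
  have := If 0%N isT; rewrite trigmom0 eqxx expr1n => <-.
  by under [RHS]eq_integral do rewrite expr0 mul1e.
pose P : probability (measurableTypeR R) R := density_prob mf f0 f1.
have PE A : measurable A ->
    P A = (\int[mu]_(y in A `&` `[(-4)%R, 4%R]) density_rho1 y)%E.
  by move=> mA; rewrite integral_mkcondr.
have P4 : P (~` `[- 4, 4]) = 0%E.
  rewrite PE; last exact: measurableC.
  by rewrite setICl integral_set0.
exists P; split => // m.
have cm : continuous (fun x : R => x ^+ m) by exact: exprn_continuous.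
have im := bounded_support_integrable P4 cm.
(* The moment recursion covers even m; for odd m both sides vanish, the left one because the density
   is even. *)
have [om|em] := boolP (odd m); last first.
  by rewrite /Rintegral (integral_density_prob im)/= If.
rewrite trigmom_cosint cosint_odd// mulr0 mul0r expr0n/=.
have Popp (A : set (measurableTypeR R)) : measurable A -> P (-%R @^-1` A) = P A.
  move=> mA.
  have fN x : f (- x) = f x.
    rewrite /f !patchE !mem_setE !in_itv/= lerNl opprK andbC lerNl; case: ifP => // _.
    by rewrite /density_rho1 sqrrN.
  transitivity (\int[mu]_x (f \_ A) (- x)%R)%E.
    rewrite /P/= /density_prob integral_mkcond; apply: eq_integral => x _.
    by rewrite !patchE fN.
  rewrite (@ge0_integral_oppr _ (f \_ A)).
  - by rewrite -integral_mkcond.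
  - by apply: (iffLR (measurable_restrictT f mA)); exact: measurable_funTS.
  - by move=> x; rewrite patchE; case: ifP.
exact: (odd_moment_eq0 Popp).
Qed.

End law1.

(** * Points of the unit circle and the ranges of the characters *)

Section unit_circle.
Variable R : realType.
Implicit Types (a b x : R) (w z : R[i]).

Lemma norm_eq1P a b : (`|a +i* b| = 1 :> R[i]) <-> a ^+ 2 + b ^+ 2 = 1.
Proof.
rewrite normc_def /=; split => [/eqP|->]; last by rewrite sqrtr1.
rewrite eq_complex/= eqxx andbT => /eqP h.
by rewrite -(sqr_sqrtr (_ : 0 <= a ^+ 2 + b ^+ 2)) ?h ?expr1n// addr_ge0 ?sqr_ge0.
Qed.

Lemma inv_unit_circle a b : a ^+ 2 + b ^+ 2 = 1 -> (a +i* b)^-1 = a -i* b.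
Proof.
move=> ab; apply: mulr1_eq; apply/eqP; rewrite eq_complex/=; apply/andP.
by split; apply/eqP; rewrite -?ab; ring.
Qed.

Lemma unit_circle_re a b : a ^+ 2 + b ^+ 2 = 1 -> -1 <= a <= 1.
Proof.
move=> ab; rewrite -ler_norml -(@ler_pXn2r _ 2)// ?nnegrE// expr1n.
rewrite real_normK ?num_real//.
by rewrite -ab lerDl sqr_ge0.
Qed.

Lemma unit_circle_sqrt a : -1 <= a <= 1 -> a ^+ 2 + Num.sqrt (1 - a ^+ 2) ^+ 2 = 1.
Proof.
move=> a1; rewrite sqr_sqrtr ?subrKC// subr_ge0.
by rewrite -real_normK ?num_real// exprn_ile1// ler_norml.
Qed.

Lemma chi_rho1_image :
  @chi_rho1 R @` @torus R = [set x%:C | x in `[(-4 : R), 4]].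
Proof.
apply/seteqP; split => [z [[[a b] [c d]] [/=]]|z [x /= + <-]].
  move=> /norm_eq1P ab /norm_eq1P cd <-.
  exists (2 * a + 2 * c).
    have /andP[h1 h2] := unit_circle_re ab; have /andP[h3 h4] := unit_circle_re cd.
    by rewrite /= in_itv/=; apply/andP; split; lra.
  rewrite /chi_rho1/= !inv_unit_circle//; apply/eqP; rewrite eq_complex/=.
  by apply/andP; split; apply/eqP; ring.
rewrite in_itv/= => /andP[x1 x2].
have h : (x / 4) ^+ 2 + Num.sqrt (1 - (x / 4) ^+ 2) ^+ 2 = 1.
  by apply: unit_circle_sqrt; apply/andP; split; lra.
(* Equal coordinates with real part x / 4 contribute x / 2 each. *)
exists ((x / 4) +i* Num.sqrt (1 - (x / 4) ^+ 2),
        (x / 4) +i* Num.sqrt (1 - (x / 4) ^+ 2)).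
  by split => /=; apply/norm_eq1P.
rewrite /chi_rho1/= !inv_unit_circle//; apply/eqP; rewrite eq_complex/=.
by apply/andP; split; apply/eqP; field.
Qed.

Lemma chi_rho2_image :
  @chi_rho2 R @` @torus R = [set y%:C | y in `[(-1 : R), 3]].
Proof.
apply/seteqP; split => [z [[[a b] [c d]] [/=]]|z [x /= + <-]].
  move=> /norm_eq1P ab /norm_eq1P cd <-.
  (* The character depends only on the product of the two coordinates, which again lies on the
     circle. *)
  have e : (a * c - b * d) ^+ 2 + (a * d + b * c) ^+ 2 = 1.
    transitivity ((a ^+ 2 + b ^+ 2) * (c ^+ 2 + d ^+ 2)); first by ring.
    by rewrite ab cd mulr1.
  exists (1 + 2 * (a * c - b * d)).
    have /andP[h1 h2] := unit_circle_re e.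
    by rewrite /= in_itv/=; apply/andP; split; lra.
  rewrite /chi_rho2/= !inv_unit_circle//; apply/eqP; rewrite eq_complex/=.
  by apply/andP; split; apply/eqP; ring.
rewrite in_itv/= => /andP[x1 x2].
pose a := (x - 1) / 2.
have h : a ^+ 2 + Num.sqrt (1 - a ^+ 2) ^+ 2 = 1.
  by apply: unit_circle_sqrt; rewrite /a; apply/andP; split; lra.
exists (a +i* Num.sqrt (1 - a ^+ 2), 1).
  by split => /=; [apply/norm_eq1P|rewrite normr1].
rewrite /chi_rho2/= invr1 !mulr1 !inv_unit_circle//; apply/eqP; rewrite eq_complex/=.
by apply/andP; split; apply/eqP; rewrite /a; field.
Qed.

(** The rational parametrization of the circle at natural numbers, a source of infinitely many
    distinct points. *)
Definition circle_point (k : nat) : R[i] :=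
  ((1 - k%:R ^+ 2) / (1 + k%:R ^+ 2)) +i* (2 * k%:R / (1 + k%:R ^+ 2)).

Lemma circle_point_norm k : `|circle_point k| = 1.
Proof.
have k0 : 1 + k%:R ^+ 2 != 0 :> R by rewrite gt_eqF// ltr_pwDl// sqr_ge0.
by apply/norm_eq1P; field.
Qed.

Lemma circle_point_inj : injective circle_point.
Proof.
have k0 k : 1 + k%:R ^+ 2 != 0 :> R by rewrite gt_eqF// ltr_pwDl// sqr_ge0.
move=> k l [+ _] => /(congr1 (fun x => x + 1)).
have e (m : nat) : (1 - m%:R ^+ 2) / (1 + m%:R ^+ 2) + 1 = 2 / (1 + m%:R ^+ 2) :> R.
  by field.
rewrite !e => /mulfI h; have {}h := h (ltac:(by rewrite pnatr_eq0)).
move: h => /invr_inj /addrI /eqP; rewrite eqrXn2// ?ler0n//.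
by rewrite eqr_nat => /eqP.
Qed.

Lemma poly_circle_eq0 (p : {poly R[i]}) : (forall z, `|z| = 1 -> p.[z] = 0) -> p = 0.
Proof.
move=> p0; apply/eqP; apply: contraT => pn0.
pose rs := [seq circle_point k | k <- iota 0 (size p)].
have := @max_poly_roots _ p rs pn0.
rewrite map_inj_uniq ?iota_uniq; last exact: circle_point_inj.
rewrite size_map size_iota ltnn => -> //.
apply/allP => _ /mapP[k _ ->]; apply/rootP/p0; exact: circle_point_norm.
Qed.

End unit_circle.

(** * Independence of monomials and the edge multiplicities *)

Section edges.
Variable R : realType.
Implicit Types (mu nu s : Z2) (S r : seq Z2) (w : R[i] * R[i]).

Lemma fsum_seq (V : nmodType) r (F : Z2 -> V) : uniq r ->
  (forall nu, nu \notin r -> F nu = 0) ->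
  \sum_(nu \in [set: Z2]) F nu = \sum_(nu <- r) F nu.
Proof.
move=> ur F0; rewrite (@fsbigE _ _ _ _ _ r)//; last by move=> nu _; exact: F0.
by apply: eq_bigl => nu; rewrite in_setT.
Qed.

Lemma sigmaD mu s w : torus w -> sigma (mu + s) w = sigma s w * sigma mu w.
Proof.
move=> [w1 w2]; have u (z : R[i]) : `|z| = 1 -> z \is a GRing.unit.
  by move=> z1; rewrite unitfE -normr_gt0 z1.
by rewrite /sigma/= !exprzDr ?u//; ring.
Qed.

Lemma sigma_circle nu (z : R[i]) (N : int) : `|z| = 1 ->
  sigma nu (z, z ^ N) = z ^ (nu.1 + N * nu.2).
Proof.
move=> z1; have u : z \is a GRing.unit by rewrite unitfE -normr_gt0 z1.
by rewrite /sigma/= exprzDr// exprz_exp.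
Qed.

Lemma torus_circle (z : R[i]) (N : int) : `|z| = 1 -> torus (z, z ^ N).
Proof.
move=> z1; split => //=.
by case: N => n; rewrite ?NegzE ?exprzN ?normfV normrX z1 expr1n ?invr1.
Qed.

(* Along w = (z, z^N) with N large, the monomials sigma nu become distinct
   powers of z. *)
Lemma sigma_independent r (c : Z2 -> R[i]) : uniq r ->
  (forall w, torus w -> \sum_(nu <- r) c nu * sigma nu w = 0) ->
  forall nu, nu \in r -> c nu = 0.
Proof.
move=> ur h.
pose B : nat := \sum_(nu <- r) (`|nu.1| + `|nu.2|)%N.
have hB nu : nu \in r -> (`|nu.1| + `|nu.2| <= B)%N.
  by move=> nur; rewrite /B (big_rem nu)//= leq_addr.
(* B bounds both coordinates on r, so first coordinates differ by at most 2B < N and nu.1 + N nu.2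
   determines nu. Adding K makes all these exponents nonnegative. *)
pose N : int := B.*2.+1%:Z.
pose K : int := (B + B.*2.+1 * B)%N%:Z.
pose e nu : nat := `|(nu.1 + N * nu.2 + K)%R|%N.
have eE nu : nu \in r -> (e nu)%:Z = nu.1 + N * nu.2 + K.
  move=> /hB h1; rewrite /e gez0_abs// /N /K; case: nu h1 => a b /=; nia.
have einj : {in r &, injective e}.
  move=> nu nu' nr nr' /(congr1 Posz); rewrite !eE// => /addIr.
  have := hB _ nr; have := hB _ nr'; rewrite /N.
  case: nu {nr} => a b; case: nu' {nr'} => a' b' /= h1 h2 h3.
  have : b = b' by nia.
  by move=> bb; move: h3; rewrite bb => /addIr ->.
pose p : {poly R[i]} := \sum_(nu <- r) c nu *: 'X^(e nu).
have p0 : p = 0.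
  apply: poly_circle_eq0 => z z1.
  have u : z \is a GRing.unit by rewrite unitfE -normr_gt0 z1.
  rewrite horner_sum; transitivity (z ^ K * \sum_(nu <- r) c nu * sigma nu (z, z ^ N)).
    rewrite mulr_sumr big_seq [RHS]big_seq; apply: eq_bigr => nu nr.
    have -> : sigma nu (z, z ^ N) = z ^ (nu.1 + N * nu.2) by exact: sigma_circle.
    rewrite hornerZ hornerXn mulrCA -exprzDr// [K + _]addrC -eE//.
  by rewrite h ?mulr0//; exact: torus_circle.
move=> nu nr; have := congr1 (fun q : {poly R[i]} => q`_(e nu)) p0.
rewrite coef0 coef_sum (big_rem nu)//= coefZ coefXn eqxx mulr1 big_seq big1 ?addr0//.
move=> nu' nr'; rewrite coefZ coefXn.
have [/einj ee|] := eqVneq (e nu) (e nu'); last by rewrite mulr0.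
move: nr'; rewrite (rem_filter _ ur) mem_filter/= => /andP[/eqP ne nr'].
by case: ne; rewrite ee.
Qed.

(** The Cayley graph of Z^2 with step set S. *)
Definition step_graph S mu nu : nat := (nu - mu \in S).

(** F receives the multiplicity as an argument, so that one reindexing serves both the characters
    and the adjacency operator. *)
Lemma step_graph_sum (V : nmodType) S mu (F : Z2 -> nat -> V) : uniq S ->
  (forall nu, F nu 0%N = 0) ->
  \sum_(nu \in [set: Z2]) F nu (step_graph S mu nu) = \sum_(s <- S) F (mu + s) 1%N.
Proof.
move=> uS F0; rewrite (@fsum_seq _ [seq mu + s | s <- S]).
- rewrite big_map big_seq [RHS]big_seq; apply: eq_bigr => s sS.
  by rewrite /step_graph addrAC subrr add0r sS.
- by rewrite map_inj_uniq//; exact: addrI.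
- move=> nu nuS; rewrite /step_graph; case: (boolP (nu - mu \in S)) => // nS.
  case/negP: nuS; apply/mapP; exists (nu - mu) => //.
  by rewrite addrC subrK.
Qed.

Lemma step_graph_support S mu : finite_set [set nu | step_graph S mu nu != 0%N].
Proof.
apply: (sub_finite_set _ (finite_seq [seq mu + s | s <- S])) => nu /=.
rewrite /step_graph eqb0 negbK => nS; apply/mapP; exists (nu - mu) => //.
by rewrite addrC subrK.
Qed.

(** The step graph satisfies the specification since monomials multiply by adding exponents. Any
    other solution differs from it, at each mu, by the coefficients of a finite vanishing
    combination of monomials. *)
Lemma step_graph_edge_multiplicity S (chi : R[i] * R[i] -> R[i]) : uniq S ->
  (forall w, torus w -> chi w = \sum_(s <- S) sigma s w) ->
  edge_multiplicity chi = step_graph S.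
Proof.
move=> uS chiS.
have eS mu w : torus w ->
    chi w * sigma mu w = \sum_(nu \in [set: Z2]) (step_graph S mu nu)%:R * sigma nu w.
  move=> tw; rewrite (step_graph_sum mu
    (F := fun nu k => k%:R * sigma nu w))//; last first.
    by move=> nu; rewrite mul0r.
  rewrite chiS// big_distrl/=; apply: eq_bigr => s _.
  by rewrite mul1r sigmaD.
apply: xget_unique => [mu|n ne] /=.
  by split; [exact: step_graph_support|exact: eS].
apply/funext => mu; apply/funext => nu.
have [fn en] := ne mu.
have fS := step_graph_support S mu.
pose U := [set nu | n mu nu != 0%N] `|` [set nu | step_graph S mu nu != 0%N].
pose r : seq Z2 := finmap.enum_fset (fset_set U).
have fU : finite_set U.
  by rewrite finite_setU.
have ur : uniq r by exact: finmap.fset_uniq.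
have nr nu' : nu' \notin r -> n mu nu' = 0%N /\ step_graph S mu nu' = 0%N.
  rewrite in_fset_set// notin_setE/= => /not_orP[/negP h1 /negP h2].
  by split; apply/eqP; rewrite -[_ == _]negbK.
have [nur|/nr[-> ->]//] := boolP (nu \in r).
pose c nu : R[i] := (n mu nu)%:R - (step_graph S mu nu)%:R.
have := @sigma_independent r c ur _ nu nur; rewrite /c => h.
apply/eqP; rewrite -(eqr_nat R[i]) -subr_eq0; apply/eqP/h => w tw.
under eq_bigr do rewrite mulrBl; rewrite sumrB.
have e1 := en w tw; have e2 := eS mu w tw; move: e1; rewrite e2.
rewrite (@fsum_seq _ r) ?(@fsum_seq _ r)//.
- by move=> ->; rewrite subrr.
- by move=> nu' /nr[-> _]; rewrite mul0r.
- by move=> nu' /nr[_ ->]; rewrite mul0r.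
Qed.

End edges.

(** * The adjacency operator on square-summable functions *)

Section operator.
Variable R : realType.
Implicit Types (f g : Z2 -> R[i]) (S : seq Z2).
Local Notation normc := (@ComplexField.Normc.normc R).

(** Termwise |a + b|^2 <= 2 |a|^2 + 2 |b|^2, with the factors 2 written as repeated sums. *)
Lemma square_summableD f g : square_summable f -> square_summable g ->
  square_summable (fun mu => f mu + g mu).
Proof.
rewrite /square_summable => sf sg.
pose F (h : Z2 -> R[i]) (mu : Z2) : \bar R := (normc (h mu) ^+ 2)%:E.
have F0 h mu : (0 <= F h mu)%E by rewrite lee_fin sqr_ge0.
apply: (@le_lt_trans _ _
    (\esum_(mu in [set: Z2]) ((F f mu + F f mu) + (F g mu + F g mu)))%E).
  apply: le_esum => mu _; rewrite /F -!EFinD lee_fin.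
  case: (f mu) (g mu) => a b [c d] /=; rewrite !sqr_sqrtr ?addr_ge0 ?sqr_ge0//.
  rewrite -subr_ge0 [leRHS](_ : _ = (a - c) ^+ 2 + (b - d) ^+ 2); last by ring.
  by rewrite addr_ge0 ?sqr_ge0.
rewrite !esumD//; try by move=> mu _; rewrite ?adde_ge0.
by rewrite !lte_add_pinfty.
Qed.

Lemma square_summable_shift f s : square_summable f ->
  square_summable (fun mu => f (mu + s)).
Proof.
rewrite /square_summable => sf.
rewrite -(@reindex_esum _ _ _ [set: Z2] [set: Z2] (fun mu => mu + s)
  (fun mu => (normc (f mu) ^+ 2)%:E))//.
split => //; first by move=> x y _ _; exact: addIr.
by move=> y _; exists (y - s) => //=; rewrite subrK.
Qed.

Lemma square_summable_step S f : square_summable f ->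
  square_summable (fun mu => \sum_(s <- S) f (mu + s)).
Proof.
move=> sf; elim: S => [|s S IH].
  rewrite /square_summable esum1 ?ltry// => mu _.
  by rewrite big_nil ComplexField.Normc.normc0 expr0n.
under [X in square_summable X]eq_fun do rewrite big_cons.
by apply: square_summableD => //; exact: square_summable_shift.
Qed.

Definition step_operator S (f : ell2 R) : ell2 R :=
  exist _ _ (square_summable_step S (svalP f)).

Lemma adjacency_step_graphP S (A : ell2 R -> ell2 R) : uniq S ->
  is_adjacency_operator (step_graph S) A <->
  forall (f : ell2 R) mu, sval (A f) mu = \sum_(s <- S) sval f (mu + s).
Proof.
move=> uS.
have e (f : ell2 R) mu : \sum_(nu \in [set: Z2]) (step_graph S mu nu)%:R * sval f nu =
    \sum_(s <- S) sval f (mu + s) :> R[i].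
  rewrite (step_graph_sum mu (F := fun nu k => k%:R * sval f nu))//; last first.
    by move=> nu; rewrite mul0r.
  by apply: eq_bigr => s _; rewrite mul1r.
by split => h f mu; rewrite h e.
Qed.

(** For distinct steps, the number of m-step walks from mu to the origin. *)
Fixpoint walks S (m : nat) (mu : Z2) : R :=
  if m is m'.+1 then \sum_(s <- S) walks S m' (mu + s) else (mu == 0)%:R.

Lemma iter_step_operator S (A : ell2 R -> ell2 R) m mu : uniq S ->
  is_adjacency_operator (step_graph S) A ->
  sval (iter m A (delta R (0, 0))) mu = (walks S m mu)%:C.
Proof.
move=> uS /(adjacency_step_graphP _ uS) AE; elim: m mu => [|m IH] mu /=.
  by rewrite /dirac_fun; case: eqP.
by rewrite AE rmorph_sum/=; apply: eq_bigr => s _.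
Qed.

(** Every partial sum over a finite set containing x equals f x, so the net of partial sums is
    eventually constant. *)
Lemma inner_delta (f : ell2 R) x : inner f (delta R x) = sval f x.
Proof.
pose F := fun mu => sval f mu * (sval (delta R x) mu)^*.
have Fx (A : finmap.finset_of (Phant Z2)) : x \in finmap.enum_fset A ->
    @summability.partial_sum Z2 R[i]^o F A = sval f x.
  move=> xA; transitivity (\sum_(mu <- finmap.enum_fset A) F mu).
    by rewrite finmap.big_seq_fsetE.
  rewrite (bigD1_seq x) ?finmap.fset_uniq//= big1 ?addr0 /F/= /dirac_fun.
    by rewrite eqxx conjC1 mulr1.
  by move=> mu /negbTE ->; rewrite conjC0 mulr0.
have FF := @summability.totally_filter Z2.
have h : @summability.partial_sum Z2 R[i]^o F @ @summability.totally Z2 -->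
    (sval f x : R[i]^o).
  have T : @summability.totally Z2
      [set A | finmap.fsubset (finmap.fset1 x) A].
    by exists (finmap.fset1 x).
  apply: cvg_near_cst; apply: (filterS _ T) => A /= xA; apply: Fx.
  by move: xA; rewrite finmap.fsub1set.
exact: (cvg_lim (@norm_hausdorff _ _) h).
Qed.

End operator.

(** * Identification of the spectral measures from walk counts *)

Section spectral.
Variable R : realType.
Implicit Types (S : seq Z2) (P : probability (measurableTypeR R) R).

Lemma compact_sub_itv (C : set R) : compact C -> exists L : R, C `<=` `[- L, L].
Proof.
move=> /compact_bounded[M [_ hM]]; exists (M + 1) => x Cx.
by rewrite /= in_itv/= -ler_norml; apply: hM Cx; rewrite ltrDl.
Qed.

Lemma spectral_measure_step_graph S P (L : R) : uniq S ->
  P (~` `[- L, L]) = 0%E ->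
  (forall m, \int[P]_t (t ^+ m) = walks R S m 0) ->
  forall A, measurable A -> spectral_measure R (step_graph S) A = P A.
Proof.
move=> uS PL Pm A mA.
have Pspec : is_spectral_measure (step_graph S) P.
  split; first by exists `[- L, L]%classic => //; exact: segment_compact.
  have adj : is_adjacency_operator (step_graph S) (@step_operator R S).
    by apply/(adjacency_step_graphP _ uS).
  exists (@step_operator R S) => // m.
  by rewrite inner_delta (iter_step_operator _ _ uS adj) Pm.
rewrite /spectral_measure.
(* The chosen Q may come with another compact set and another operator, but it has the same moments,
   and one interval [-M, M] carries both Q and P. *)
case: xgetP => [Q _ /= [[C cC QC] [B Badj Bm]]|h]; last first.
  by case: (h P).
have [L' CL'] := compact_sub_itv cC.
pose M := Num.max L L'.
have sub (K K' : R) : K <= K' -> ~` `[- K', K']%classic `<=` ~` `[- K, K]%classic.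
  move=> KK' x; apply: contra_not; rewrite /= !in_itv/= => /andP[h1 h2].
  by apply/andP; split; lra.
have mc (K : R) : measurable (~` `[- K, K]%classic : set (measurableTypeR R)).
  exact: measurableC.
apply: (@moments_determine _ _ _ M) => //.
- have mC : measurable (~` C : set (measurableTypeR R)).
    by apply: measurableC; exact: compact_measurable.
  apply: (subset_measure0 (mc _) mC _ QC).
  apply: (subset_trans (sub L' M _)); first by rewrite le_max lexx orbT.
  exact: subsetC.
- by apply: (subset_measure0 (mc _) (mc L) _ PL); apply: sub; rewrite le_max lexx.
- move=> m; have := Bm m; rewrite inner_delta (iter_step_operator _ _ uS Badj) -Pm.
  by move=> [].
Qed.

Definition steps1 : seq Z2 := [:: (1, 0); (-1, 0); (0, 1); (0, -1)].
Definition steps2 : seq Z2 := [:: (0, 0); (1, 1); (-1, -1)].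

Lemma chi_rho1_steps w : @torus R w -> chi_rho1 w = \sum_(s <- steps1) sigma s w.
Proof.
move=> _; rewrite /steps1 !big_cons big_nil /chi_rho1 /sigma/=.
by rewrite !expr0z !expr1z !exprN1 !mulr1 !mul1r addr0 !addrA.
Qed.

Lemma chi_rho2_steps w : @torus R w -> chi_rho2 w = \sum_(s <- steps2) sigma s w.
Proof.
move=> _; rewrite /steps2 !big_cons big_nil /chi_rho2 /sigma/=.
by rewrite !expr0z !expr1z !exprN1 !mulr1 addr0 !addrA.
Qed.

(* In the coordinates i + j and i - j a step of the walk is a pair of
   independent one-dimensional steps. *)
Lemma walks_steps1 m (i j : int) :
  walks R steps1 m (i, j) = trigmom (0 : R) m (i + j) * trigmom 0 m (i - j).
Proof.
elim: m i j => [|m IH] i j.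
  rewrite /= !trigmom0 -natrM mulnb; congr (_%:R); congr nat_of_bool.
  by rewrite [LHS]xpair_eqE; lia.
rewrite [LHS]/= /steps1 !big_cons big_nil/= !IH !trigmomS.
have -> : i + 1 + (j + 0) = i + j + 1 by ring.
have -> : i + 1 - (j + 0) = i - j + 1 by ring.
have -> : i + -1 + (j + 0) = i + j - 1 by ring.
have -> : i + -1 - (j + 0) = i - j - 1 by ring.
have -> : i + 0 + (j + 1) = i + j + 1 by ring.
have -> : i + 0 - (j + 1) = i - j - 1 by ring.
have -> : i + 0 + (j + -1) = i + j - 1 by ring.
have -> : i + 0 - (j + -1) = i - j + 1 by ring.
by ring.
Qed.

(** The steps preserve the diagonal and act on it as a rest and moves by 1 and -1, which is the
    recursion of [trigmom] at a = 1. *)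
Lemma walks_steps2 m (k : int) : walks R steps2 m (k, k) = trigmom 1 m k.
Proof.
elim: m k => [|m IH] k.
  rewrite /= trigmom0; congr (_%:R); congr nat_of_bool.
  by rewrite [LHS]xpair_eqE andbb.
by rewrite [LHS]/= /steps2 !big_cons big_nil/= !IH trigmomS !addr0; ring.
Qed.

End spectral.

(** * The ranges of the characters and the two spectral measures *)

Unset Implicit Arguments.

Theorem theorem8p3 (R : realType) :
  (@chi_rho1 R @` @torus R = [set x%:C | x in `[(-4 : R), 4]] /\
   @chi_rho2 R @` @torus R = [set y%:C | y in `[(-1 : R), 3]]) /\
  (forall A : set (measurableTypeR R), measurable A ->
     spectral_measure R (edge_multiplicity (@chi_rho1 R)) A =
     (\int[lebesgue_measure]_(x in A `&` `[(-4)%R, 4%R]) density_rho1 x)%E) /\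
  (forall A : set (measurableTypeR R), measurable A ->
     spectral_measure R (edge_multiplicity (@chi_rho2 R)) A =
     (\int[lebesgue_measure]_(y in A `&` `[(-1)%R, 3%R]) density_rho2 y)%E).
Proof.
split; first by split; [exact: chi_rho1_image|exact: chi_rho2_image].
split => A mA.
- have u1 : uniq steps1 by [].
  have [P [PE P4 Pm]] := law_rho1 R.
  rewrite (step_graph_edge_multiplicity u1 (@chi_rho1_steps R)) -PE//.
  apply: (spectral_measure_step_graph u1 P4) => // m.
  by rewrite Pm (walks_steps1 R m 0 0) !addr0 expr2.
- have u2 : uniq steps2 by [].
  have [P [PE P4 Pm]] := law_rho2 R.
  rewrite (step_graph_edge_multiplicity u2 (@chi_rho2_steps R)) -PE//.
  apply: (spectral_measure_step_graph u2 P4) => // m.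
  by rewrite Pm (walks_steps2 R m 0).
Qed.
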